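(* Let $Q^*\subset[0,1]$ be the smallest set such that $0,1\in Q^*$ and, whenever $\ell/k\in Q^*$ (in lowest terms) and $p$ is a prime not dividing $\ell$, both $\frac{\ell}{kp}$ and $1-\frac{\ell}{kp}$ belong to $Q^*$. Then for exact solutions of $\alpha$-ICD with $n$ agents: (1) if $\alpha=\ell/k\in Q^*$ (in lowest terms), then every instance with $n$ agents has an exact solution using at most $\frac{2(k-1)}{k}\cdot n$ cuts; (2) if $\alpha$ is rational and $\alpha\notin Q^*$, then there is a constant $c_\alpha>0$ such that for every $n$, every instance with $n$ agents has an exact solution using at most $(2-c_\alpha)\cdot n$ cuts; (3) if $\alpha$ is irrational, then every instance with $n$ agents has an exact solution using at most $2n$ cuts.
   Context: $\alpha$-Imbalanced-Consensus-Division ($\alpha$-ICD), for $\alpha\in[0,1]$: an instance with $n$ agents consists of $n$ probability measures $\mu_1,\dots,\mu_n$ on $[0,1]$, each absolutely continuous with a piecewise-constant density. A solution with $c$ cuts is given by cut points $0<t_1<\dots<t_c<1$ partitioning $[0,1]$ into $c+1$ subintervals, each labelled ''$+$'' or ''$-$''; $A_+$ is the union of the ''$+$'' subintervals. The solution is exact if $\mu_i(A_+)=\alpha$ for all $i\in[n]$. *)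

(* Defs.v *)
From HB Require Import structures.
From mathcomp Require Import all_boot all_order all_algebra.
From mathcomp Require Import all_classical all_reals all_analysis.
Set Implicit Arguments.
Unset Strict Implicit.
Unset Printing Implicit Defensive.
Import Order.TTheory GRing.Theory Num.Theory.
Import numFieldNormedType.Exports.
Local Open Scope classical_set_scope.
Local Open Scope ring_scope.

(* [t] subdivides the unit interval iff 0 < t_1 < ... < t_c < 1. *)
Definition subdivision (R : realType) (t : seq R) : Prop :=
  path <%R 0 (rcons t 1).

(* With t_0 = 0 and t_(c+1) = 1, [endpoint t i] is t_i for i <= c + 1. *)
Definition endpoint (R : realType) (t : seq R) (i : nat) : R :=
  nth 1 (0 :: rcons t 1) i.

(* The values at the finitely many breakpoints are left arbitrary. *)
Definition piecewise_constant (R : realType) (f : R -> R) : Prop :=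
  exists2 s : seq R, subdivision s &
    forall i : nat, (i <= size s)%N ->
      exists v : R, forall x : R,
        endpoint s i < x < endpoint s i.+1 -> f x = v.

(* A probability measure on [0, 1] is represented by a Borel probability
   measure on the line that is carried by [0, 1]; the last clause of
   [pc_density] forces this, as well as absolute continuity. *)
Definition pc_density (R : realType)
    (mu : probability (measurableTypeR R) R) (f : R -> R) : Prop :=
  [/\ forall x : R, 0 <= x <= 1 -> 0 <= f x,
      piecewise_constant f &
      forall A : set (measurableTypeR R), measurable A ->
        mu A =
          (\int[lebesgue_measure]_(x in A `&` `[0%R, 1%R]%classic) (f x)%:E)%E].

Definition icd_instance (R : realType) (n : nat)
    (mu : 'I_n -> probability (measurableTypeR R) R) : Prop :=
  forall i : 'I_n, exists f : R -> R, pc_density (mu i) f.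

(* [true] is the label "+". The subintervals are taken closed: two of them
   share at most a cut point, which is null for every measure of an instance. *)
Definition plus_part (R : realType) (c : nat)
    (t : c.-tuple R) (lab : c.+1.-tuple bool) : set (measurableTypeR R) :=
  \bigcup_(i in [set i : 'I_c.+1 | tnth lab i])
    `[endpoint t i, endpoint t i.+1]%classic.

Definition exact_solution (R : realType) (alpha : R) (n : nat)
    (mu : 'I_n -> probability (measurableTypeR R) R)
    (c : nat) (t : c.-tuple R) (lab : c.+1.-tuple bool) : Prop :=
  subdivision t /\ forall i : 'I_n, mu i (plus_part t lab) = alpha%:E.

Definition exactly_solvable_within (R : realType) (alpha : R) (n : nat)
    (mu : 'I_n -> probability (measurableTypeR R) R) (b : R) : Prop :=
  exists (c : nat) (t : c.-tuple R) (lab : c.+1.-tuple bool),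
    exact_solution alpha mu t lab /\ c%:R <= b.

Inductive Qstar (R : realType) : R -> Prop :=
| Qstar0 : Qstar 0
| Qstar1 : Qstar 1
| Qstar_div (l k p : nat) :
    (0 < k)%N -> coprime l k -> Qstar (l%:R / k%:R) ->
    prime p -> ~~ (p %| l)%N -> Qstar (l%:R / (k * p)%:R)
| Qstar_compl (l k p : nat) :
    (0 < k)%N -> coprime l k -> Qstar (l%:R / k%:R) ->
    prime p -> ~~ (p %| l)%N -> Qstar (1 - l%:R / (k * p)%:R).

(* Main.v *)
(** Everything rests on splitting a necklace among a prime number p of thieves
    with n (p - 1) cuts. Cut [0, 1] into many small cells; a division
    with few cuts is a labelling of the cells by Z/p. Sliding one new cut along
    [0, 1] contracts any cycle of labellings, so there are chains e_0, e_1, ...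
    of tuples of nearby labellings, with at most k cuts in e_k, such that the
    boundary of e_(k+1) is alternately (g - 1) e_k and (1 + g + ... + g^(p-1)) e_k
    mod p, where g shifts the labels. For each measure, the label of a thief with
    the largest share is an equivariant function of the labelling, and the
    Vandermonde determinant of p such labels is an invariant cocycle which is
    nonzero only if all p thieves occur. By Stokes, the cup product of these n
    cocycles takes the value (((p-1)/2)! V(0, ..., p-1))^n on e_(n(p-1)) (1 if
    p = 2), which is nonzero mod p, so
    some tuple of nearby labellings lets every thief be the richest for every
    measure: each of them is a nearly fair division.

    Splitting a set with share alpha and c cuts in this way and keeping the
    thief with the fewest cuts yields share alpha / p with at most
    (c + 2 n (p - 1)) / p cuts. Iterating this and complementing gives (1), and,
    along Euclid's algorithm, (2) for every rational alpha. A limit of nearly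
    exact solutions with boundedly many cuts is exact, which gives (3) as well. *)
Require Import Defs.
From HB Require Import structures.
From mathcomp Require Import all_boot all_order all_algebra.
From mathcomp Require Import all_classical all_reals all_analysis.
From mathcomp Require Import zify ring lra.
Set Implicit Arguments.
Unset Strict Implicit.
Unset Printing Implicit Defensive.
Import Order.TTheory GRing.Theory Num.Theory.
Import numFieldNormedType.Exports.
Local Open Scope ring_scope.

(** * Ordered cochains *)

Section Cochains.
Variable A : comNzRingType.

(** The simplicial coboundary of ordered cochains; [cobdE] recovers the usual alternating sum over
    deleted vertices. A cochain is defined on tuples of all lengths at once. *)
Fixpoint cobd (T : Type) (f : seq T -> A) (s : seq T) : A :=
  if s is x :: s' then f s' - cobd (fun z => f (x :: z)) s' else 0.

Lemma cobd_map (T U : Type) (g : T -> U) (f : seq U -> A) (s : seq T) :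
  cobd (fun z => f (map g z)) s = cobd f (map g s).
Proof. by elim: s f => //= x s IHs f; rewrite -IHs. Qed.

Lemma cobdB (T : Type) (f g : seq T -> A) (s : seq T) :
  cobd (fun z => f z - g z) s = cobd f s - cobd g s.
Proof. by elim: s f g => [|x s IHs] f g /=; rewrite ?subrr // IHs; ring. Qed.

Lemma cobd_sum (T I : Type) (r : seq I) (f : I -> seq T -> A) (s : seq T) :
  cobd (fun z => \sum_(i <- r) f i z) s = \sum_(i <- r) cobd (f i) s.
Proof.
elim: s f => [|x s IHs] f /=; first by rewrite big1.
by rewrite IHs -sumrB.
Qed.

Lemma cobdZ (T : Type) (c : A) (f : seq T -> A) (s : seq T) :
  cobd (fun z => c * f z) s = c * cobd f s.
Proof. by elim: s f => [|x s IHs] f /=; rewrite ?mulr0 // IHs mulrBr. Qed.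

Lemma cobdE (T : Type) (f : seq T -> A) (s : seq T) :
  cobd f s = \sum_(i < size s) (-1) ^+ i * f (take i s ++ drop i.+1 s).
Proof.
elim: s f => [|x s IHs] f /=; first by rewrite big_ord0.
rewrite big_ord_recl /= expr0 mul1r drop0 IHs -sumrN; congr (_ + _).
by apply: eq_bigr => i _; rewrite exprS mulN1r mulNr.
Qed.

(** Here [b] has degree [m]: the front and the back face share vertex [m]. *)
Definition cup (T : Type) (m : nat) (b w : seq T -> A) (s : seq T) : A :=
  b (take m.+1 s) * w (drop m s).

(** The Leibniz rule, by induction on [m]: fixing the first vertex lowers the degree of [b] by
    one. *)
Lemma cobd_cup (T : Type) (m : nat) (b w : seq T -> A) (s : seq T) :
  (m.+1 < size s)%N ->
  cobd (cup m b w) s =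
    cobd b (take m.+2 s) * w (drop m.+1 s) +
    (-1) ^+ m * (b (take m.+1 s) * cobd w (drop m s)).
Proof.
elim: m b s => [|m IHm] b [|x s] //= sm.
  case: s sm => [|y s] //= _; rewrite /cup /= !take0 expr0 mul1r.
  by rewrite -[in LHS]/(b [:: x]) cobdZ /=; ring.
rewrite -[X in _ - X]/(cobd (cup m (fun z => b (x :: z)) w) s) IHm //.
rewrite /cup /= exprS; ring.
Qed.

Section Prism.
Variables (T : Type) (phi psi : T -> T).

(** Dual to the triangulation of a simplex times an interval: the alternating sum of [f] over (phi
    x_0, ..., phi x_i, psi x_i, ..., psi x_n). It is a homotopy between the pullbacks along [phi]
    and [psi]. *)
Fixpoint prism (f : seq T -> A) (s : seq T) : A :=
  if s is x :: s' then
    f (phi x :: map psi s) - prism (fun z => f (phi x :: z)) s'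
  else 0.

Lemma eq_prism (f g : seq T -> A) s : f =1 g -> prism f s = prism g s.
Proof.
elim: s f g => //= x s IHs f g fg; rewrite fg; congr (_ - _).
by apply: IHs => z; apply: fg.
Qed.

Lemma prismB (f g : seq T -> A) (s : seq T) :
  prism (fun z => f z - g z) s = prism f s - prism g s.
Proof. by elim: s f g => [|x s IHs] f g /=; rewrite ?subrr // IHs; ring. Qed.

Lemma prism_cobd (f : seq T -> A) s :
  prism (cobd f) s + cobd (prism f) s = f (map psi s) - f (map phi s).
Proof.
elim: s f => [|x s IHs] f /=; first by rewrite !subrr addr0.
pose fx z := f (phi x :: z).
rewrite -/(cobd (fun z => fx z)) prismB (cobdB (fun z => fx (psi x :: map psi z))).
rewrite (cobd_map psi (fun z => fx (psi x :: z))).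
have := IHs fx; rewrite {3 4}/fx -/fx => IH.
rewrite -[f (phi x :: map psi s)]/(fx (map psi s)).
have -> : prism (cobd fx) s = fx (map psi s) - fx (map phi s) - cobd (prism fx) s.
  by rewrite -IH; ring.
rewrite /fx; ring.
Qed.

(** Turns algebraic nonvanishing into an actual tuple: some simplex of the prism must carry a
    nonzero value. *)
Lemma prism_neq0 (f : seq T -> A) s : prism f s != 0 ->
  exists s', [/\ f s' != 0, size s' = (size s).+1 &
    forall y, List.In y s' -> exists2 x, List.In x s & y = phi x \/ y = psi x].
Proof.
elim: s f => [|x s IHs] f /=; first by rewrite eqxx.
have [f0|f0 _] := eqVneq (f (phi x :: psi x :: map psi s)) 0.
  rewrite f0 sub0r oppr_eq0 => /IHs[s' [fs' ss' s'P]].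
  exists (phi x :: s'); split => //=; first by rewrite ss'.
  move=> y [<-|/s'P[z zs yz]]; first by exists x; [left|left].
  by exists z => //; right.
exists (phi x :: psi x :: map psi s); split; rewrite ?size_map //= ?size_map //.
move=> y [<-|[<-|]]; [by exists x; [left|left]|by exists x; [left|right]|].
move=> /List.in_map_iff[z [<- zs]]; exists z; [by right|by right].
Qed.

End Prism.
End Cochains.

(** * Chains of labellings *)

Section Action.
Variables (p : nat) (p_pr : prime p).
Variables (T : Type) (act : 'F_p -> T -> T).
Hypothesis act0 : forall x, act 0 x = x.
Hypothesis actD : forall a b x, act a (act b x) = act (a + b) x.
Implicit Types (f g : seq T -> 'F_p) (s : seq T).

(** These are the differentials of the 2-periodic resolution for the cyclic group of order p, acting
    on cochains: the norm for odd [k], g - 1 for even [k]. *)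
Definition nrm f s : 'F_p := \sum_(a : 'F_p) f (map (act a) s).
Definition dif f s : 'F_p := f (map (act 1) s) - f s.
Definition res k f s : 'F_p := if odd k then nrm f s else dif f s.

Lemma map_actD a b s : map (act a) (map (act b) s) = map (act (a + b)) s.
Proof. by rewrite -map_comp; apply: eq_map => x /=. Qed.

Lemma map_act0 s : map (act 0) s = s.
Proof. by rewrite (eq_map act0) map_id. Qed.

Lemma res_res k f s : res k (res k.+1 f) s = 0.
Proof.
rewrite /res /=; case: (odd k) => /=.
  rewrite /nrm /dif sumrB; apply/eqP; rewrite subr_eq0; apply/eqP.
  under eq_bigr do rewrite map_actD.
  by rewrite [RHS](reindex_inj (addrI (1 : 'F_p))).
rewrite /dif /nrm; apply/eqP; rewrite subr_eq0; apply/eqP.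
under eq_bigr do rewrite map_actD.
by rewrite [RHS](reindex_inj (addIr (1 : 'F_p))).
Qed.

Lemma res_cobd k f s : res k (cobd f) s = cobd (res k f) s.
Proof.
rewrite /res; case: ifP => _; rewrite /nrm /dif.
  by rewrite cobd_sum; apply: eq_bigr => a _; rewrite cobd_map.
by rewrite cobdB cobd_map.
Qed.

Lemma resB k f g s : res k (fun z => f z - g z) s = res k f s - res k g s.
Proof. by rewrite /res /nrm /dif; case: ifP => _; rewrite ?sumrB //; ring. Qed.

Lemma eq_res k f g s :
  (forall z, size z = size s -> f z = g z) -> res k f s = res k g s.
Proof.
move=> fg; rewrite /res /nrm /dif; case: ifP => _.
  by apply: eq_bigr => a _; rewrite fg ?size_map.
by rewrite !fg ?size_map.
Qed.

(** For an invariant cochain the difference is 0 and the norm is p times the cochain, which is 0 mod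
    p. *)
Lemma res_inv k f s : (forall a, f (map (act a) s) = f s) -> res k f s = 0.
Proof.
move=> fs; rewrite /res /nrm /dif; case: ifP => _; last by rewrite fs subrr.
under eq_bigr do rewrite fs.
by rewrite sumr_const card_Fp // -mulr_natr pchar_Fp_0 ?mulr0.
Qed.

Lemma res_neq0 k f s : res k f s != 0 -> exists a, f (map (act a) s) != 0.
Proof.
move=> rf; apply: contrapT => /forallNP f0; case/negP: rf; apply/eqP.
have {}f0 a : f (map (act a) s) = 0 by have /negP := f0 a; rewrite negbK => /eqP.
rewrite /res /nrm /dif; case: ifP => _; first by rewrite big1.
by rewrite f0 -(map_act0 s) f0 subrr.
Qed.

Lemma res_cup k m (b w : seq T -> 'F_p) s :
  (forall a z, b (map (act a) z) = b z) ->
  res k (cup m b w) s = cup m b (res k w) s.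
Proof.
move=> b_inv; rewrite /res /nrm /dif /cup; case: ifP => _.
  by rewrite mulr_sumr; apply: eq_bigr => a _; rewrite -map_take b_inv map_drop.
by rewrite -map_take b_inv map_drop mulrBr.
Qed.

End Action.

(** Modulo 2, g - 1 and 1 + g coincide, so for p = 2 the parity of the degree is immaterial. *)
Lemma nrm_dif2 (p : nat) (T : Type) (act : 'F_p -> T -> T)
    (f : seq T -> 'F_p) s :
  p = 2 -> (forall x, act 0 x = x) -> nrm act f s = dif act f s.
Proof.
move=> p2 act0; subst p; rewrite /nrm /dif.
have -> : f (map (act 1) s) - f s = f (map (act 1) s) + f s.
  by rewrite oppr_pchar2 // pchar_Fp.
rewrite (bigD1 (1 : 'F_2)) //= (bigD1 (0 : 'F_2)) //= big_pred0 ?addr0.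
  by rewrite (eq_map act0) map_id.
by case=> [[|[|]]].
Qed.

(** * Labellings of the cells and the contraction that builds the chains e_k *)

Section Labelings.
Variables (p : nat) (p_pr : prime p) (m : nat).
Local Notation V := (nat -> 'F_p).

Definition shift (a : 'F_p) (X : V) : V := fun j => a + X j.

Lemma shift0 X : shift 0 X = X.
Proof. by apply/funext => j; rewrite /shift add0r. Qed.

Lemma shiftD a b X : shift a (shift b X) = shift (a + b) X.
Proof. by apply/funext => j; rewrite /shift addrA. Qed.

Definition changes (T : eqType) (X : nat -> T) : nat :=
  (\sum_(j < m) (X j != X j.+1))%N.

Definition distance (X Y : V) : nat := (\sum_(j < m.+1) (X j != Y j))%N.

(* Beyond the last cell [m] the labels are irrelevant; truncating the index
   makes [blank m.+1] constant. *)
Definition blank (i : nat) (X : V) : V :=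
  fun j => if (minn j m < i)%N then 0 else X j.

Lemma blank0 X : blank 0 X = X.
Proof. by apply/funext => j; rewrite /blank ltn0. Qed.

Lemma blank_all X : blank m.+1 X = fun=> 0.
Proof. by apply/funext => j; rewrite /blank ltnS geq_minr. Qed.

Lemma changes_shift a X : changes (shift a X) = changes X.
Proof. by apply: eq_bigr => j _; rewrite /shift (inj_eq (addrI a)). Qed.

Lemma distance_shift a X Y : distance (shift a X) (shift a Y) = distance X Y.
Proof. by apply: eq_bigr => j _; rewrite /shift (inj_eq (addrI a)). Qed.

Lemma sum_eq1 (n i : nat) : (\sum_(j < n) (j == i :> nat) <= 1)%N.
Proof.
elim: n => [|n IHn]; first by rewrite big_ord0.
rewrite big_ord_recr /=; have [<-|_] := eqVneq n i; last by rewrite addn0.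
rewrite big1 // => j _; have := ltn_ord j; lia.
Qed.

(** Only the boundary between cells i - 1 and i can become a new change. *)
Lemma changes_blank i X : (changes (blank i X) <= (changes X).+1)%N.
Proof.
rewrite -(addn1 (changes X)).
apply: leq_trans (leq_add (leqnn _) (sum_eq1 m i.-1)).
rewrite -big_split /=; apply: leq_sum => j _; rewrite /blank.
have jm := ltn_ord j.
rewrite (minn_idPl (ltnW jm)) (minn_idPl jm).
case: (ltnP j i) => ji; case: (ltnP j.+1 i) => ji'; rewrite ?eqxx //.
  have -> : (j == i.-1 :> nat) by lia.
  lia.
- lia.
- lia.
Qed.

(** Off cell [i] both blankings erase the same labels, so only that cell can add a disagreement. *)
Lemma distance_blank i k l X Y : (k <= 1)%N -> (l <= 1)%N ->
  (distance (blank (i + k) X) (blank (i + l) Y) <= (distance X Y).+1)%N.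
Proof.
move=> k1 l1; rewrite -(addn1 (distance X Y)).
apply: leq_trans (leq_add (leqnn _) (sum_eq1 m.+1 i)).
rewrite -big_split /=; apply: leq_sum => j _; rewrite /blank.
have jm : (j <= m)%N by rewrite -ltnS.
rewrite (minn_idPl jm).
have [ji|ji|->] := ltngtP j i.
- by rewrite !ltn_addr.
- by do 2![rewrite ifF; last by lia]; lia.
- lia.
Qed.

(** Contracts all labellings to the constant 0 by blanking one cell at a time. Each prism involves
    only two consecutive blankings, which is what keeps the resulting tuples tight. *)
Definition htpy (f : seq V -> 'F_p) (s : seq V) : 'F_p :=
  \sum_(i < m.+1) prism (blank i) (blank i.+1) f s.

Lemma htpyB f g s : htpy (fun z => f z - g z) s = htpy f s - htpy g s.
Proof. by rewrite /htpy -sumrB; apply: eq_bigr => i _; rewrite prismB. Qed.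

Lemma eq_htpy f g s : f =1 g -> htpy f s = htpy g s.
Proof. by move=> fg; apply: eq_bigr => i _; apply: eq_prism. Qed.

Lemma htpy_cobd f s :
  htpy (cobd f) s = f (nseq (size s) (fun=> 0)) - f s - cobd (htpy f) s.
Proof.
apply/eqP; rewrite eq_sym subr_eq eq_sym; apply/eqP.
rewrite /htpy cobd_sum -big_split /=.
under eq_bigr do rewrite prism_cobd.
rewrite -(big_mkord xpredT (fun i => f (map (blank i.+1) s) - f (map (blank i) s))).
rewrite telescope_sumr // (eq_map blank0) map_id; congr (f _ - _).
by rewrite (eq_map blank_all); elim: s => //= x s ->.
Qed.

(* [ev k] is the functional "evaluate on the chain e_k", where e_0 is the
   constant labelling and the boundary of e_(k+1) is (g - 1) e_k or
   (1 + g + ... + g^(p-1)) e_k, with g the shift by one, alternately: e_(k+1)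
   is swept out by contracting that cycle to a point, which costs one more cut. *)
Fixpoint ev (k : nat) (f : seq V -> 'F_p) : 'F_p :=
  if k is k'.+1 then - ev k' (res shift k' (htpy f)) else f [:: fun=> 0].

Lemma eq_ev_all k f g : f =1 g -> ev k f = ev k g.
Proof.
elim: k f g => [|k IHk] f g fg /=; first by rewrite fg.
by congr (- _); apply: IHk => s; apply: eq_res => z _; apply: eq_htpy.
Qed.

Lemma evB k f g : ev k (fun z => f z - g z) = ev k f - ev k g.
Proof.
elim: k f g => [|k IHk] f g //=.
rewrite -opprB opprK addrC -IHk; congr (- _); apply: eq_ev_all => s.
by rewrite -resB; apply: eq_res => z _; rewrite htpyB.
Qed.

Lemma ev0 k : ev k (fun=> 0) = 0.
Proof.
rewrite (@eq_ev_all k _ (fun=> 0 - 0)); first by rewrite evB subrr.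
by move=> s; rewrite subrr.
Qed.

(** Stokes for e_(k+1). Contracting the chain obtained from e_k leaves that chain itself, a constant
    part killed by [res_inv], and the contraction of its boundary, which vanishes because
    consecutive differentials compose to 0. *)
Lemma ev_cobd k f : ev k.+1 (cobd f) = ev k (res shift k f).
Proof.
elim: k f => [|k IHk] f.
  rewrite /= /res /dif /= !htpy_cobd /=.
  by rewrite /htpy big1 ?subr0; [ring|move=> i _].
rewrite -[LHS]/(- ev k.+1 (res shift k.+1 (htpy (cobd f)))).
pose g := res shift k.+1 (htpy f).
rewrite (@eq_ev_all _ _ (fun s => (0 - res shift k.+1 f s) - cobd g s)) => [|s].
  rewrite evB (evB _ (fun=> 0)) IHk ev0 sub0r -opprD opprK.
  rewrite (@eq_ev_all k _ (fun=> 0)) ?ev0 ?addr0 // => s.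
  exact/res_res/shiftD.
rewrite (@eq_res _ _ _ _ _ (fun z => (f (nseq (size z) (fun=> 0)) - f z) - cobd (htpy f) z));
  last by move=> z _; exact: htpy_cobd.
rewrite !resB res_cobd (@res_inv p p_pr _ shift _ (fun z => f (nseq (size z) (fun=> 0)))).
  by rewrite /g; ring.
by move=> a; rewrite size_map.
Qed.

Definition tight (k : nat) (s : seq V) : Prop :=
  [/\ size s = k.+1, forall X, List.In X s -> (changes X <= k)%N &
      forall X Y, List.In X s -> List.In Y s -> (distance X Y <= k)%N].

(** A nonzero value is traced back to one simplex of e_k. Each contraction costs at most one change
    and one unit of distance, and shifts cost nothing. *)
Lemma ev_neq0 k f : ev k f != 0 -> exists2 s, tight k s & f s != 0.
Proof.
elim: k f => [|k IHk] f /=.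
  move=> f0; exists [:: fun=> 0] => //; split=> //= [X [<-|//]|X Y [<-|//] [<-|//]].
    by rewrite /changes big1 // => j _; rewrite eqxx.
  by rewrite /distance big1 // => j _; rewrite eqxx.
rewrite oppr_eq0 => /IHk[s0 [s0k s0c s0d]] /(res_neq0 shift0)[a].
rewrite /htpy; set s := map _ _ => sn0.
have [sk sc sd] : tight k s.
  split; first by rewrite size_map.
    by move=> X /List.in_map_iff[Y [<- ?]]; rewrite changes_shift; exact: s0c.
  move=> X Y /List.in_map_iff[X' [<- ?]] /List.in_map_iff[Y' [<- ?]].
  by rewrite distance_shift; exact: s0d.
have [i pi0] : exists i : 'I_m.+1, prism (blank i) (blank i.+1) f s != 0.
  apply: contrapT => /forallNP pr0; case/negP: sn0; rewrite big1 // => i _.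
  by have /negP := pr0 i; rewrite negbK => /eqP.
have [s' [fs' ss' s'P]] := prism_neq0 pi0; exists s' => //; split.
- by rewrite ss' sk.
- by move=> X /s'P[Y Ys [->|->]]; apply: leq_trans (changes_blank _ _) _; exact: sc.
- move=> X Y /s'P[X' X's XE] /s'P[Y' Y's YE].
  have {XE}[k1 k1P ->] : exists2 k1, (k1 <= 1)%N & X = blank (i + k1) X'.
    by case: XE => ->; [exists 0%N; rewrite ?addn0|exists 1%N; rewrite ?addn1].
  have {YE}[l1 l1P ->] : exists2 k1, (k1 <= 1)%N & Y = blank (i + k1) Y'.
    by case: YE => ->; [exists 0%N; rewrite ?addn0|exists 1%N; rewrite ?addn1].
  by apply: leq_trans (distance_blank _ _ _ _ _) _ => //; exact: sd.
Qed.

Lemma eq_ev k f g : (forall s, size s = k.+1 -> f s = g s) -> ev k f = ev k g.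
Proof.
move=> fg; apply/eqP; rewrite -subr_eq0 -evB; apply: contraT.
by move=> /ev_neq0[s [sk _ _]]; rewrite fg // subrr eqxx.
Qed.

Lemma evZ k c f : ev k (fun s => c * f s) = c * ev k f.
Proof.
elim: k f => [|k IHk] f //=; rewrite mulrN -IHk; congr (- _).
have prismZ (g : seq V -> 'F_p) phi psi s :
    prism phi psi (fun z => c * g z) s = c * prism phi psi g s.
  by elim: s g => [|x s IHs] g /=; rewrite ?mulr0 // IHs mulrBr.
apply: eq_ev_all => s; rewrite /res; case: ifP => _; rewrite /nrm /dif /htpy.
  rewrite mulr_sumr; apply: eq_bigr => a _.
  by rewrite mulr_sumr; apply: eq_bigr => i _; rewrite prismZ.
by rewrite mulrBr !mulr_sumr; congr (_ - _); apply: eq_bigr => i _; rewrite prismZ.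
Qed.

End Labelings.

(** * Vandermonde cocycles *)

Section Vandermonde.
Variable A : idomainType.
Implicit Types (s t : seq A).

Fixpoint vdm s : A := if s is x :: s' then (\prod_(y <- s') (y - x)) * vdm s' else 1.

Lemma vdm_det s :
  vdm s = \det (Vandermonde (size s) (\row_(j < size s) s`_j)).
Proof.
rewrite det_Vandermonde; elim: s => [|x s IHs] /=; first by rewrite big_ord0.
rewrite big_ord_recl IHs; congr (_ * _).
  rewrite [RHS]big_mkcond [RHS]big_ord_recl /= mul1r (big_nth 0) big_mkord.
  by apply: eq_bigr => j _; rewrite !mxE.
apply: eq_bigr => i _; rewrite [RHS]big_mkcond [RHS]big_ord_recl /= mul1r big_mkcond.
by apply: eq_bigr => j _; rewrite !mxE.
Qed.

(** A matrix whose first two rows are both constant 1 has determinant 0; its expansion along the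
    first row is the alternating sum of the Vandermonde determinants with one entry deleted. *)
Lemma cobd_vdm s : (1 < size s)%N -> cobd vdm s = 0.
Proof.
case: s => [|x0 [|x1 s]] // _; set t := x0 :: _; set n := size s.
pose B := \matrix_(i < n.+2, j < n.+2) (if val i is k.+1 then t`_j ^+ k else 1).
have : \det B = 0.
  apply: (@determinant_alternate _ _ _ ord0 (inord 1)).
    by rewrite -(inj_eq val_inj) /= inordK.
  by move=> j; rewrite !mxE /= inordK.
rewrite (expand_det_row B ord0) cobdE => B0; rewrite -[RHS]B0.
apply: eq_bigr => j _; rewrite mxE mul1r /cofactor add0n; congr (_ * _).
have tj : size (take j t ++ drop j.+1 t) = n.+1.
  rewrite size_cat size_drop size_takel; last exact: ltnW (ltn_ord j).
  by have := ltn_ord j; rewrite /= -/n; lia.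
rewrite vdm_det tj; congr (\det _); apply/matrixP => i k; rewrite !mxE /=.
congr (_ ^+ _); rewrite nth_cat size_takel; last exact: ltnW (ltn_ord j).
case: ltnP => kj; first by rewrite nth_take // /bump leqNgt kj.
by rewrite nth_drop /bump kj; congr nth; lia.
Qed.

Lemma vdm_shift a s : vdm (map (+%R a) s) = vdm s.
Proof.
elim: s => //= x s ->; congr (_ * _); rewrite big_map.
by apply: eq_bigr => y _; ring.
Qed.

Lemma vdm_neq0 s : (vdm s != 0) = uniq s.
Proof.
elim: s => [|x s IHs] /=; first by rewrite oner_eq0.
rewrite mulf_eq0 negb_or IHs; congr (_ && _).
rewrite prodf_seq_neq0; apply/allP/idP => [xs|xs y ys].
  by apply/negP => /xs; rewrite subrr eqxx.
by rewrite subr_eq0; apply: contraNneq xs => <-.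
Qed.

End Vandermonde.

(** * Evaluating cup products by descent in the degree *)

Section Descent.
Variables (p : nat) (p_pr : prime p).
Local Notation tr := (fun a x : 'F_p => a + x).

(** The cone with apex 0, which gives a primitive of a cocycle. *)
Definition cone (w : seq 'F_p -> 'F_p) (z : seq 'F_p) : 'F_p := w (0 :: z).

Fixpoint descend (q : nat) (w : seq 'F_p -> 'F_p) : seq 'F_p -> 'F_p :=
  if q is q'.+1 then descend q' (res tr q' (cone w)) else w.

(** Each step replaces the cocycle [w] by [res] of its primitive, one degree lower, while the
    invariant cocycle [b] is carried along. The conditions on [d] say that it behaves as an even
    degree. *)
Lemma ev_cup_descend (m d : nat) (h : (nat -> 'F_p) -> 'F_p)
    (b : seq (nat -> 'F_p) -> 'F_p) (q : nat) (w : seq 'F_p -> 'F_p) :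
  (forall a X, h (shift a X) = a + h X) ->
  (forall a z, b (map (shift a) z) = b z) ->
  (forall s, size s = d.+2 -> cobd b s = 0) ->
  (-1) ^+ d = 1 :> 'F_p ->
  (forall q f s, res (@shift p) (d + q) f s = res (@shift p) q f s) ->
  (forall s, size s = q.+2 -> cobd w s = 0) ->
  ((0 < q)%N -> forall s, size s = q.+1 -> res tr q.-1 w s = 0) ->
  ev m (d + q) (cup d b (fun z => w (map h z))) =
    descend q w [:: 0] * ev m d b.
Proof.
move=> h_eq b_inv b_cyc sgn_d res_d.
elim: q w => [|q IHq] w w_cyc w_res.
  rewrite addn0 -evZ //; apply: eq_ev => // s sd.
  rewrite /cup take_oversize ?sd // mulrC; congr (_ * _).
  have : size (drop d s) = 1%N by rewrite size_drop sd subSnn.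
  case: (drop d s) => [|X [|]] //= _.
  (* In degree 0 a cocycle is constant, so its value at [h X] is its value at 0. *)
  by have := w_cyc [:: 0; h X] erefl; rewrite /= subr0 => /eqP; rewrite subr_eq0 => /eqP.
have cone_w z : size z = q.+2 -> cobd (cone w) z = w z.
  move=> zq; have := w_cyc (0 :: z); rewrite /= zq => /(_ erefl)/eqP.
  by rewrite subr_eq0 => /eqP.
(* As [b] is a cocycle, the Leibniz rule makes the cup product a coboundary; Stokes then lowers the
   degree, and [res] passes to the second factor because [b] is invariant. *)
rewrite addnS (@eq_ev _ p_pr _ _ _ (cobd (cup d b (fun z => cone w (map h z))))).
  rewrite (ev_cobd p_pr) /= -IHq.
  - apply: eq_ev => // s sq; rewrite res_d res_cup //.
    rewrite /cup; congr (_ * _); rewrite /res /nrm /dif.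
    case: ifP => _; [apply: eq_bigr => a _|congr (_ - _)];
      by congr (cone w _); rewrite -!map_comp; apply: eq_map => X /=.
  - move=> s sq; rewrite -res_cobd -(w_res isT s sq) /=.
    by apply: eq_res => z zs; rewrite cone_w // zs sq.
  - by case: q {IHq w_cyc w_res cone_w} => // q _ s _; apply: res_res => a c x; rewrite addrA.
move=> s sq; rewrite cobd_cup ?sq; last by lia.
rewrite b_cyc; last by rewrite size_takel // sq; lia.
rewrite mul0r add0r sgn_d mul1r /cup cobd_map cone_w //.
by rewrite size_map size_drop sq; lia.
Qed.
End Descent.

(** * The descent of the Vandermonde cocycle *)

Section PairSums.
Variables (p : nat) (p_pr : prime p).
Local Notation tr := (fun a x : 'F_p => a + x).
Implicit Types (f : seq 'F_p -> 'F_p) (t z : seq 'F_p).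

Definition pairsum f z : 'F_p := \sum_(b : 'F_p) f [:: b, b + 1 & z].

(** Two descent steps, a difference followed by a norm, prepend (0, 1) and sum over shifts; the term
    starting with (0, 0) vanishes. By invariance this is a sum over prepended pairs (b, b + 1). *)
Lemma descend_pairsum j f :
  (forall a z, f (map (tr a) z) = f z) -> (forall z, ~~ uniq z -> f z = 0) ->
  descend j.*2.+1 f [:: 0] = iter j pairsum f [:: 0; 1].
Proof.
elim: j f => [|j IHj] f f_inv f0.
  by rewrite /= /res /dif /cone /= addr0 (f0 [:: 0; 0]) ?subr0 //= !inE eqxx.
rewrite iterSr -IHj.
- rewrite doubleS /=.
  suff -> : res tr j.*2.+1 (cone (res tr j.*2.+2 (cone f))) = pairsum f by [].
  apply/funext => z; rewrite /res /= odd_double /= /nrm /pairsum.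
  rewrite [RHS](reindex_inj (inj_comp oppr_inj (addrI (1 : 'F_p)))) /=.
  apply: eq_bigr => a _; rewrite /cone /dif /= (f0 [:: 0, 0 & _]); last first.
    by rewrite cons_uniq mem_head.
  rewrite subr0 -[RHS](f_inv (1 + a)) /=; congr f; congr [:: _, _ & _]; try by ring.
  by rewrite -map_comp; apply: eq_map => x /=; rewrite addrA.
- move=> a z; rewrite /pairsum (reindex_inj (addrI a)).
  apply: eq_bigr => b _; rewrite -[RHS](f_inv a) /=; congr f.
  by rewrite addrA.
- move=> z zu; rewrite /pairsum big1 // => b _; apply: f0.
  by rewrite /= !negb_and !negbK zu !orbT.
Qed.

Lemma iter_pairsum_nrm j f z :
  iter j pairsum (nrm tr f) z = nrm tr (iter j pairsum f) z.
Proof.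
elim: j z => [|j IHj] z //=; rewrite /pairsum.
under eq_bigr do rewrite IHj; rewrite /nrm exchange_big /=.
apply: eq_bigr => a _; rewrite [RHS](reindex_inj (addrI a)) /=.
by apply: eq_bigr => b _; rewrite addrA.
Qed.

Fixpoint flat t : seq 'F_p :=
  if t is x :: t' then [:: x, x + 1 & flat t'] else [::].

Fixpoint words (j : nat) : seq (seq 'F_p) :=
  if j is j'.+1 then [seq b :: t | b <- enum 'F_p, t <- words j'] else [:: [::]].

Lemma mem_words j t : (t \in words j) = (size t == j).
Proof.
elim: j t => [|j IHj] t /=; first by rewrite inE size_eq0.
apply/allpairsP/idP => [[[b s] /= [_ sj ->]]|]; first by rewrite /= eqSS -IHj.
by case: t => // b t; rewrite /= eqSS -IHj => tj; exists (b, t); rewrite mem_enum.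
Qed.

Lemma words_uniq j : uniq (words j).
Proof.
elim: j => //= j IHj; apply: allpairs_uniq => //; first exact: enum_uniq.
by move=> [b s] [c t] _ _ /= [-> ->].
Qed.

Lemma iter_pairsumE j f z :
  iter j pairsum f z = \sum_(t <- words j) f (flat t ++ z).
Proof.
elim: j f => [|j IHj] f; first by rewrite big_seq1.
rewrite iterSr IHj /= big_allpairs_dep /= exchange_big /=.
by rewrite big_enum.
Qed.

Lemma big_flat (F : 'F_p -> 'F_p) t :
  \prod_(y <- flat t) F y = \prod_(x <- t) (F x * F (x + 1)).
Proof.
by elim: t => [|x t IHt]; rewrite ?big_nil //= !big_cons IHt mulrA.
Qed.

Lemma mem_flat t x : (x \in flat t) = (x \in t) || (x - 1 \in t).
Proof.
elim: t => //= y t IHt; rewrite !inE IHt subr_eq.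
by case: (x == y); case: (x == y + 1); case: (x \in t); rewrite ?orbT.
Qed.

Lemma size_flat t : size (flat t) = (size t).*2.
Proof. by elim: t => //= x t ->. Qed.

(** The four differences between the pairs at x and at z multiply to (z - x)^2 ((z - x)^2 - 1),
    which is symmetric in x and z. Hence the order of the pairs does not affect the determinant. *)
Lemma vdm_flat_cat s t :
  vdm (flat (s ++ t)) = vdm (flat s) * vdm (flat t) *
    \prod_(x <- s) \prod_(z <- t) ((z - x) ^+ 2 * ((z - x) ^+ 2 - 1)).
Proof.
elim: s => [|x s IHs] /=; first by rewrite big_nil mulr1 mul1r.
rewrite IHs !big_cons !big_flat !big_cat /= -!mulrA.
set a := \prod_(i <- s) _; set b := \prod_(i <- t) _.
set c := \prod_(i <- s) _; set d := \prod_(i <- t) _.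
set e := \prod_(z <- t) _.
have -> : e = b * d by rewrite /e -big_split /=; apply: eq_bigr => z _; ring.
ring.
Qed.

Lemma vdm_flat_perm s t : perm_eq s t -> vdm (0 :: flat s) = vdm (0 :: flat t).
Proof.
move=> st; rewrite /= !big_flat (perm_big _ st) /=; congr (_ * _).
apply/esym; move: st (erefl (vdm (flat s))).
pose P u := vdm (flat u) = vdm (flat s).
apply: (@catCA_perm_ind _ P) => {t} s1 s2 s3; rewrite /P => <-.
pose W (u v : seq 'F_p) :=
  \prod_(x <- u) \prod_(z <- v) ((z - x) ^+ 2 * ((z - x) ^+ 2 - 1)).
have W_cat u v w : W u (v ++ w) = W u v * W u w.
  by rewrite /W -big_split; apply: eq_bigr => x _; rewrite big_cat.
have W_sym u v : W u v = W v u.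
  rewrite /W exchange_big /=; apply: eq_bigr => x _; apply: eq_bigr => z _; ring.
rewrite !vdm_flat_cat -!/(W _ _) !W_cat (W_sym s2 s1); ring.
Qed.

Lemma flat_disj t x : uniq (flat t) -> x \in t -> x + 1 \notin t.
Proof.
elim: t => //= y t IHt; rewrite !inE !mem_flat !negb_or.
move=> /and3P[/and3P[y1 yt y1t] /andP[yt' _] /IHt{}IHt].
case/predU1P => [->|xt]; first by rewrite eq_sym y1.
rewrite IHt // andbT; apply: contraNneq y1t => <-; by rewrite addrK.
Qed.

(** The starting points of the pairs (1, 2), (3, 4), ..., which tile the nonzero residues when p =
    2j + 1. *)
Definition odds (j : nat) : seq 'F_p := [seq (r.*2.+1)%:R | r <- iota 0 j].

Lemma natF_inj i j : (i < p)%N -> (j < p)%N -> i%:R = j%:R :> 'F_p -> i = j.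
Proof.
move=> ip jp /(congr1 val); rewrite /= !val_Fp_nat //.
by rewrite !modn_small.
Qed.

Lemma flat_odds j : 0 :: flat (odds j) = [seq i%:R | i <- iota 0 j.*2.+1].
Proof.
rewrite /= /odds; congr cons.
suff H k : flat [seq (r.*2.+1)%:R | r <- iota k j] = [seq i%:R | i <- iota k.*2.+1 j.*2].
  exact: H.
elim: j k => //= j IHj k; rewrite IHj doubleS; congr [:: _, _ & _].
by rewrite -[RHS]natr1.
Qed.

Lemma uniq_flat_odds j : (j.*2 < p)%N -> uniq (0 :: flat (odds j)).
Proof.
move=> jp; rewrite flat_odds map_inj_in_uniq ?iota_uniq // => x y.
rewrite !mem_iota /= !add0n => xj yj; apply: natF_inj; lia.
Qed.

Lemma uniq_odds j : (j.*2 < p)%N -> uniq (odds j).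
Proof.
move=> jp; rewrite map_inj_in_uniq ?iota_uniq // => x y.
rewrite !mem_iota /= !add0n => xj yj.
move=> /(natF_inj (i := x.*2.+1) (j := y.*2.+1)) H.
by have /succn_inj/double_inj : x.*2.+1 = y.*2.+1 by apply: H; lia.
Qed.

(* Going upwards, 2r+1 can only be covered by the pair starting at 2r+1. *)
Lemma flat_perm_odds j t : p = j.*2.+1 -> size t = j -> uniq (0 :: flat t) ->
  perm_eq t (odds j).
Proof.
move=> pj tj tu.
have full x : x \in (0 : 'F_p) :: flat t.
  have sz : (size (enum 'F_p) <= size (0%R :: flat t))%N.
    by rewrite -cardE card_Fp //= size_flat tj -pj.
  have sub : {subset (0 : 'F_p) :: flat t <= enum 'F_p} by move=> y _; rewrite mem_enum.
  by rewrite (uniq_min_size tu sub sz).2 mem_enum.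
have odd_t r : (r < j)%N -> (r.*2.+1)%:R \in t.
  elim: r => [|r IHr] rj; have := full ((_.*2.+1)%:R).
    move=> /(_ 0%N); rewrite inE oner_eq0 /= mem_flat subrr => /orP[//|t0].
    by move: tu; rewrite /= mem_flat t0.
  move=> /(_ r.+1); rewrite inE => /predU1P[/(@natF_inj _ 0)|].
    by move=> H; suff: (r.+1.*2.+1 = 0)%N by []; apply: H; lia.
  rewrite mem_flat => /orP[//|]; rewrite -natr1 addrK doubleS -natr1 => rt.
  have := flat_disj (x := (r.*2.+1)%:R) _ (IHr (ltnW rj)).
  by rewrite rt => /(_ (andP tu).2).
have ou : uniq (odds j) by apply: uniq_odds; rewrite pj.
have sub : {subset odds j <= t}.
  by move=> x /mapP[r]; rewrite mem_iota add0n /= => rj ->; exact: odd_t.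
have sz : (size t <= size (odds j))%N by rewrite size_map size_iota tj.
rewrite perm_sym; apply: uniq_perm => //; first exact: leq_size_uniq ou sub sz.
by have [] := uniq_min_size ou sub sz.
Qed.

Lemma fact_neq0 j : (j < p)%N -> (j`!)%:R != 0 :> 'F_p.
Proof.
elim: j => [|j IHj] jp; first by rewrite fact0 oner_eq0.
rewrite factS natrM mulf_neq0 ?IHj //; last exact: ltnW.
by apply/eqP => /(natF_inj (j := 0) jp (ltn_trans (ltn0Sn j) jp)).
Qed.

(** For odd p the descent is a sum of determinants over words of (p - 1)/2 pairs. A term survives
    only if 0 and the pairs exhaust F_p, that is, for the ((p - 1)/2)! orderings of [odds], and all
    these terms are equal. *)
Lemma descend_vdm_neq0 : descend p.-1 (@vdm _) [:: 0 : 'F_p] != 0.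
Proof.
have [p2|p_odd] := even_prime p_pr.
  have -> : p.-1 = 1%N by rewrite p2.
  rewrite /= /res /dif /cone /= !big_seq1 !big_nil addr0 subrr mul0r !subr0 !mulr1.
  exact: oner_neq0.
have [j pj] : exists j, p = j.+1.*2.+1.
  exists (p./2.-1); have := odd_double_half p; rewrite p_odd /=.
  by have := prime_gt1 p_pr; lia.
rewrite pj [X in descend X]/= -pj.
rewrite -[descend _ _]/(descend j.*2.+1 (res tr j.*2.+1 (cone (@vdm _)))).
have -> : res tr j.*2.+1 (cone (@vdm _)) = nrm tr (cone (@vdm _)).
  by rewrite /res /= odd_double.
rewrite descend_pairsum; last first.
- move=> z zu; rewrite /nrm big1 // => a _; apply/eqP; rewrite -[_ == 0]negbK vdm_neq0 /=.
  by rewrite (map_inj_uniq (addrI a)) (negbTE zu) andbF.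
- move=> a z; rewrite /nrm [RHS](reindex_inj (addIr a)) /=; apply: eq_bigr => b _.
  by rewrite -map_comp; congr (cone _ _); apply: eq_map => x /=; rewrite addrA.
rewrite iter_pairsum_nrm.
(* Summing over all shifts of (0, 1) is one more pair sum, so there are j + 1 = (p - 1)/2 pairs. *)
have -> : nrm tr (iter j pairsum (cone (@vdm _))) [:: 0; 1] =
          iter j.+1 pairsum (cone (@vdm _)) [::].
  by rewrite /nrm /= /pairsum; apply: eq_bigr => a _; rewrite addr0.
rewrite iter_pairsumE.
have -> : \sum_(t <- words j.+1) cone (@vdm _) (flat t ++ [::]) =
   \sum_(t <- permutations (odds j.+1)) vdm (0 :: flat (odds j.+1)).
  rewrite [LHS]big_seq (eq_bigr (fun t =>
    if perm_eq t (odds j.+1) then vdm (0 :: flat (odds j.+1)) else 0)).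
  rewrite -big_seq -big_mkcond -big_filter; apply: perm_big; apply: uniq_perm.
  - by rewrite filter_uniq // words_uniq.
  - exact: permutations_uniq.
  - move=> t; rewrite mem_filter mem_permutations mem_words andbC.
    case: eqP => //= ts; apply/esym/negbTE; apply/negP => /perm_size.
    by rewrite size_map size_iota.
  move=> t; rewrite mem_words cats0 => /eqP tj; case: ifP => [/vdm_flat_perm//|tp].
  apply/eqP/negPn; rewrite vdm_neq0; apply/negP => /(flat_perm_odds pj tj).
  by rewrite tp.
rewrite big_const_seq count_predT iter_addr_0 size_permutations.
  rewrite -mulr_natl mulf_neq0 ?vdm_neq0 ?fact_neq0 //.
    by rewrite size_map size_iota; lia.
  by apply: uniq_flat_odds; rewrite [X in (_ < X)%N]pj.
by apply: uniq_odds; rewrite [X in (_ < X)%N]pj.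
Qed.
End PairSums.

(** * Splitting among p thieves *)

Section Rainbow.
Variables (p : nat) (p_pr : prime p).
Local Notation V := (nat -> 'F_p).
Variable h : nat -> V -> 'F_p.
Hypothesis h_eq : forall i a X, h i (shift a X) = a + h i X.

Fixpoint rainbow (n : nat) : seq V -> 'F_p :=
  if n is n'.+1 then
    cup (n' * p.-1) (rainbow n') (fun z => vdm (map (h n') z))
  else fun=> 1.

Lemma rainbow_shift n a z : rainbow n (map (shift a) z) = rainbow n z.
Proof.
elim: n z => //= n IHn z; rewrite /cup -map_take -map_drop IHn; congr (_ * _).
rewrite -[RHS](vdm_shift a) -!map_comp; congr vdm.
by apply: eq_map => X; rewrite /= h_eq.
Qed.

Lemma cobd_rainbow n s : size s = (n * p.-1).+2 -> cobd (rainbow n) s = 0.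
Proof.
have p1 := prime_gt1 p_pr.
elim: n s => [|n IHn] s.
  by case: s => [|X [|Y [|]]] //= _; rewrite subr0 subrr.
rewrite mulSn => sn /=; rewrite cobd_cup ?sn; last by lia.
rewrite IHn ?mul0r ?add0r; last by rewrite size_takel // sn; lia.
rewrite cobd_map cobd_vdm ?mulr0 //.
by rewrite size_map size_drop sn; lia.
Qed.

(** Each factor contributes one descent constant. Its degree p - 1 is even for odd p, and for p = 2
    neither signs nor parity matter. *)
Lemma ev_rainbow m n :
  ev m (n * p.-1) (rainbow n) = descend p.-1 (@vdm _) [:: 0 : 'F_p] ^+ n.
Proof.
have p1 := prime_gt1 p_pr.
have pe : odd p -> odd p.-1 = false by case: (p) p1 => //= k _ /negbTE.
elim: n => [|n IHn] //=; rewrite mulSn addnC exprS -IHn.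
apply: ev_cup_descend => //.
- exact: rainbow_shift.
- exact: cobd_rainbow.
- have [p2|p_odd] := even_prime p_pr.
    rewrite oppr_pchar2 ?expr1n // -{1}p2; exact: pchar_Fp.
  by rewrite -signr_odd oddM pe // andbF.
- move=> q f s; have [p2|p_odd] := even_prime p_pr.
    by rewrite /res !(nrm_dif2 _ _ p2 (@shift0 p)) !if_same.
  by rewrite /res oddD oddM pe // andbF.
- by move=> s sp; apply: cobd_vdm; rewrite sp.
- move=> _ s _; apply: res_inv => // a; exact: vdm_shift.
Qed.

Lemma map_In (T : Type) (f : T -> 'F_p) g s :
  g \in map f s -> exists2 X, List.In X s & f X = g.
Proof.
elim: s => //= X s IHs; rewrite inE => /predU1P[->|/IHs[Y Ys fY]].
  by exists X; [left|].
by exists Y; [right|].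
Qed.

(** Each Vandermonde factor sees p consecutive vertices; if it is nonzero, their p labels are
    distinct and so exhaust F_p. *)
Lemma rainbow_neq0 n s : size s = (n * p.-1).+1 -> rainbow n s != 0 ->
  forall i g, (i < n)%N -> exists2 X, List.In X s & h i X = g.
Proof.
have p1 := prime_gt1 p_pr.
elim: n s => // n IHn s sn /=; rewrite /cup mulf_eq0 negb_or => /andP[b0 v0] i g.
set d := (n * p.-1)%N in b0 v0 *; rewrite mulSn -/d in sn.
rewrite ltnS leq_eqVlt => /predU1P[->|i_n]; last first.
  have [|X Xs <-] := IHn _ _ b0 i g i_n; first by rewrite size_takel // sn; lia.
  exists X => //; rewrite -(cat_take_drop d.+1 s).
  by apply/List.in_app_iff; left.
have [|X Xs <-] := @map_In _ (h n) g (drop d s).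
  have sz : (size (enum 'F_p) <= size (map (h n) (drop d s)))%N.
    by rewrite -cardE card_Fp // size_map size_drop sn; lia.
  have sub : {subset map (h n) (drop d s) <= enum 'F_p}.
    by move=> y _; rewrite mem_enum.
  by rewrite vdm_neq0 in v0; rewrite (uniq_min_size v0 sub sz).2 mem_enum.
exists X => //; rewrite -(cat_take_drop d s).
by apply/List.in_app_iff; right.
Qed.

Lemma exists_rainbow m n : exists2 s : seq V, tight m (n * p.-1) s &
  forall i g, (i < n)%N -> exists2 X, List.In X s & h i X = g.
Proof.
have [|s st rs] := @ev_neq0 _ p_pr m (n * p.-1) (rainbow n).
  by rewrite ev_rainbow expf_neq0 // descend_vdm_neq0.
by exists s => //; apply: rainbow_neq0 => //; case: st.
Qed.

End Rainbow.

(** * Nearly fair divisions from rainbow tuples *)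

Section Splitting.
Variables (R : realFieldType) (p : nat) (p_pr : prime p) (m : nat).
Local Notation V := (nat -> 'F_p).

Definition share (u : nat -> R) (X : V) (g : 'F_p) : R :=
  \sum_(j < m.+1) u j *+ (X j == g).

Lemma sum_share u X : \sum_g share u X g = \sum_(j < m.+1) u j.
Proof.
rewrite exchange_big /=; apply: eq_bigr => j _.
rewrite (bigD1 (X j)) //= eqxx big1 ?addr0 // => g gX.
by rewrite eq_sym (negbTE gX).
Qed.

Lemma share_distance u eta X Y g : (forall j, 0 <= u j <= eta) ->
  share u X g - share u Y g <= (distance m X Y)%:R * eta.
Proof.
move=> ueta; rewrite /share -sumrB /distance natr_sum mulr_suml.
apply: ler_sum => j _; have /andP[u0 u1] := ueta j.
have e0 : 0 <= eta by exact: le_trans u0 u1.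
have [->|XY] := eqVneq (X j) (Y j); first by rewrite subrr mul0r.
rewrite mul1r; case: (X j == g); case: (Y j == g) => /=; rewrite ?mulr1n ?mulr0n; lra.
Qed.

(* Ties are broken relative to the label of cell 0, which keeps the choice
   equivariant. *)
Definition richest (u : nat -> R) (X : V) : 'F_p :=
  X 0%N + [arg max_(d > (0 : 'F_p)) share u X (X 0%N + d)]%O.

Lemma richest_shift u a X : richest u (shift a X) = a + richest u X.
Proof.
rewrite /richest /shift addrA; congr (_ + _).
congr (Order.arg_max _ _ _); apply/funext => d.
by apply: eq_bigr => j _; rewrite -addrA (inj_eq (addrI a)).
Qed.

Lemma richestP u X g : share u X g <= share u X (richest u X).
Proof.
rewrite /richest; case: Order.TotalTheory.arg_maxP => // d _ max_d.
by rewrite -[g](subrK (X 0%N)) addrC; exact: max_d.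
Qed.

(** Every thief is richest somewhere in the tuple, hence gets at least the average there, and nearly
    as much in the nearby labelling [Y]. The lower bounds for the other thieves give the upper
    bound. *)
Lemma splitting (n : nat) (w : nat -> nat -> R) (eta : R) :
  (forall i j, 0 <= w i j <= eta) ->
  exists2 Y : V, (changes m Y <= n * p.-1)%N &
    forall i g, (i < n)%N ->
      `|share (w i) Y g - (\sum_(j < m.+1) w i j) / p%:R| <=
        p%:R * ((n * p.-1)%:R * eta).
Proof.
move=> w_eta; have p1 := prime_gt1 p_pr.
have [s [s_sz s_ch s_d] sP] := exists_rainbow p_pr (fun i => richest_shift (w i)) m n.
case: s s_sz s_ch s_d sP => // Y s _ s_ch s_d sP.
exists Y; first by apply: s_ch; left.
move=> i g i_n; set S := \sum_(j < _) _; set N := (n * p.-1)%N in s_d *.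
have p0 : 0 < p%:R :> R by rewrite ltr0n prime_gt0.
have e0 : 0 <= eta by have /andP[a b] := w_eta i 0%N; exact: le_trans a b.
have lb g' : S / p%:R - N%:R * eta <= share (w i) Y g'.
  have [X Xs hX] := sP i g' i_n.
  have : S / p%:R <= share (w i) X g'.
    rewrite ler_pdivrMr // /S -(sum_share (w i) X) -hX.
    have -> c : c * p%:R = \sum_(g : 'F_p) c :> R.
      by rewrite sumr_const card_Fp // mulr_natr.
    by apply: ler_sum => g'' _; exact: richestP.
  have := share_distance X Y g' (w_eta i).
  have : (distance m X Y)%:R * eta <= N%:R * eta.
    by rewrite ler_wpM2r // ler_nat; apply: s_d => //; left.
  lra.
have ub : share (w i) Y g <= S / p%:R + p%:R * (N%:R * eta).
  have := sum_share (w i) Y; rewrite (bigD1 g) //= -/S => SE.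
  have : \sum_(g' | g' != g) (S / p%:R - N%:R * eta) <= \sum_(g' | g' != g) share (w i) Y g'.
    by apply: ler_sum => g' _; exact: lb.
  rewrite sumr_const cardC1 card_Fp // -(mulr_natr (_ - _)).
  have -> : p.-1%:R = p%:R - 1 :> R by rewrite -subn1 natrB // prime_gt0.
  have -> : (S / p%:R - N%:R * eta) * (p%:R - 1) =
     S - S / p%:R - p%:R * (N%:R * eta) + N%:R * eta.
    by field; rewrite gt_eqF.
  have : 0 <= N%:R * eta by rewrite mulr_ge0.
  move: SE; lra.
have : N%:R * eta <= p%:R * (N%:R * eta).
  by rewrite ler_peMl ?mulr_ge0 // ler1n prime_gt0.
by rewrite ler_norml; move: (lb g) ub; lra.
Qed.

End Splitting.

(** * Approximate solutions on a grid *)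

(** A change of [A] affects one thief only; a change of [Y] inside [A] affects the two thieves who
    meet there. *)
Lemma sum_changes_and (p m : nat) (A : nat -> bool) (Y : nat -> 'F_p) :
  (\sum_(g : 'F_p) changes m (fun j => A j && (Y j == g)) <=
     changes m A + 2 * changes m Y)%N.
Proof.
rewrite exchange_big /= /changes big_distrr /= -big_split /=.
apply: leq_sum => j _; set a := A j; set b := A j.+1.
have sum_eq (y : 'F_p) : (\sum_(g : 'F_p) (y == g) = 1)%N.
  rewrite (bigD1 y) //= eqxx big1 // => g; by rewrite eq_sym => /negbTE->.
case: a; case: b => /=.
- have [->|YY] := eqVneq (Y j) (Y j.+1); first by rewrite big1 // => g _; rewrite eqxx.
  rewrite (_ : (_ + 2 * _)%N = (1 + 1)%N) // -{1}(sum_eq (Y j)) -(sum_eq (Y j.+1)).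
  rewrite -big_split /=.
  by apply: leq_sum => g _; case: (_ == g); case: (_ == g).
- under eq_bigr do rewrite eqbF_neg negbK.
  by rewrite sum_eq.
- under eq_bigr do rewrite eq_sym eqbF_neg negbK.
  by rewrite sum_eq.
- by rewrite big1.
Qed.

(* [0, 1] is cut into m + 1 cells, of measure [w i j] for the i-th agent. *)
Definition approximable (R : realType) (alpha b : R) : Prop :=
  forall n : nat, exists2 C : R, 0 <= C &
    forall (m : nat) (w : nat -> nat -> R) (eta : R),
      (forall i j, 0 <= w i j <= eta) ->
      exists2 A : nat -> bool, (changes m A)%:R <= b * n%:R &
        forall i, (i < n)%N ->
          `|\sum_(j < m.+1) w i j *+ A j - alpha * \sum_(j < m.+1) w i j|
             <= C * eta.

Section Approximable.
Variable R : realType.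
Implicit Types alpha b : R.

Lemma changes_const (T : eqType) m (x : T) : changes m (fun=> x) = 0%N.
Proof. by rewrite /changes big1 // => j _; rewrite eqxx. Qed.

Lemma approximable0 : approximable (0 : R) 0.
Proof.
move=> n; exists 0 => // m w eta _; exists (fun=> false).
  by rewrite changes_const mul0r.
by move=> i _; rewrite big1 // !mul0r subr0 normr0.
Qed.

Lemma approximableC alpha b : approximable alpha b -> approximable (1 - alpha) b.
Proof.
move=> ab n; have [C C0 CP] := ab n; exists C => // m w eta w_eta.
have [A Ab AP] := CP m w eta w_eta; exists (fun j => ~~ A j).
  by move: Ab; congr (_%:R <= _); apply: eq_bigr => j _; case: (A j); case: (A j.+1).
move=> i i_n; have := AP i i_n; congr (_ <= _); rewrite -normrN; congr (`|_|).
have -> : \sum_(j < m.+1) w i j *+ ~~ A j =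
          \sum_(j < m.+1) w i j - \sum_(j < m.+1) w i j *+ A j.
  rewrite -sumrB; apply: eq_bigr => j _.
  by case: (A j); rewrite ?subrr ?subr0.
ring.
Qed.

(** The thieves together have at most b n + 2 n (p - 1) changes, so the one with the fewest has at
    most a p-th of that. *)
Lemma approximable_div alpha b (p : nat) : prime p -> approximable alpha b ->
  approximable (alpha / p%:R) ((b + 2 * (p%:R - 1)) / p%:R).
Proof.
move=> p_pr ab n; have [C C0 CP] := ab n.
have p0 : 0 < p%:R :> R by rewrite ltr0n prime_gt0.
have p1 : 1 <= p%:R :> R by rewrite ler1n prime_gt0.
set N := (n * p.-1)%N.
exists (C + p%:R * N%:R) => [|m w eta w_eta]; first by rewrite addr_ge0 ?mulr_ge0.
have e0 : 0 <= eta by have /andP[x y] := w_eta 0%N 0%N; exact: le_trans x y.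
have [A Ab AP] := CP m w eta w_eta.
have [|Y YN YP] := @splitting R p p_pr m n (fun i j => w i j *+ A j) eta.
  by move=> i j; have /andP[x y] := w_eta i j; case: (A j); rewrite ?mulr1n ?mulr0n ?x ?lexx.
pose B g j := A j && (Y j == g).
have [g gP] : exists g, (p * changes m (B g) <= changes m A + 2 * N)%N.
  exists [arg min_(g < (0%R : 'F_p)) changes m (B g)]%N.
  case: arg_minnP => // g _ g_min.
  apply: leq_trans (leq_trans (sum_changes_and m A Y) _); last first.
    by rewrite leq_add2l leq_mul2l.
  have -> c : (p * c)%N = (\sum_(g : 'F_p) c)%N.
    by rewrite sum_nat_const card_Fp.
  by apply: leq_sum => g' _; exact: g_min.
exists (B g) => [|i i_n].
  rewrite mulrAC ler_pdivlMr //.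
  have : (p * changes m (B g))%:R <= (changes m A + 2 * N)%:R :> R by rewrite ler_nat.
  rewrite natrM natrD natrM /N natrM.
  have -> : p.-1%:R = p%:R - 1 :> R by rewrite -subn1 natrB // prime_gt0.
  by move: Ab; nra.
have := YP i g i_n; rewrite /share.
have -> : \sum_(j < m.+1) w i j *+ A j *+ (Y j == g) = \sum_(j < m.+1) w i j *+ B g j.
  by apply: eq_bigr => j _; rewrite -mulrnA mulnb.
set S := \sum_(j < m.+1) w i j *+ B g j; set SA := \sum_(j < m.+1) w i j *+ A j.
set T := \sum_(j < m.+1) w i j.
have {}AP : `|SA - alpha * T| / p%:R <= C * eta.
  rewrite ler_pdivrMr //; apply: le_trans (AP i i_n) _.
  by rewrite ler_peMr // mulr_ge0.
have -> : S - alpha / p%:R * T = (S - SA / p%:R) + (SA - alpha * T) / p%:R.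
  by field; rewrite gt_eqF.
move=> SS; apply: le_trans (ler_normD _ _) _.
rewrite normrM [`|p%:R^-1|]gtr0_norm ?invr_gt0 //.
by rewrite addrC mulrDl -(mulrA _ N%:R); exact: lerD.
Qed.

(** Prime factors are divided out one by one; the new bound is an average of [b] and p - 1 copies of
    2, so it stays below 2. *)
Lemma approximable_divn alpha b (q : nat) : (0 < q)%N -> b < 2 ->
  approximable alpha b -> exists2 b', b' < 2 & approximable (alpha / q%:R) b'.
Proof.
elim/ltn_ind: q => q IHq q0 b2 ab.
have [q1|q1] := leqP q 1.
  exists b => //; have -> : q = 1%N by lia.
  by rewrite divr1.
have [pp pq] := (pdiv_prime q1, pdiv_dvd q).
have p1 := prime_gt1 pp.
have [||b' b'2 b'P] := IHq (q %/ pdiv q)%N _ _ b2 ab.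
- by rewrite ltn_Pdiv.
- by rewrite divn_gt0 ?prime_gt0 // dvdn_leq.
exists ((b' + 2 * ((pdiv q)%:R - 1)) / (pdiv q)%:R).
  have : 0 < (pdiv q)%:R :> R by rewrite ltr0n prime_gt0.
  by move=> ?; rewrite ltr_pdivrMr //; lra.
have -> : alpha / q%:R = alpha / (q %/ pdiv q)%N%:R / (pdiv q)%:R.
  by rewrite -[in LHS](divnK pq) natrM invfM mulrA.
exact: approximable_div.
Qed.

(* Euclid: with k = q l + r, complementing r / k and dividing by q gives l / k,
   and r < l. *)
Lemma approximable_rational (l k : nat) : (0 < k)%N -> (l <= k)%N ->
  exists2 b : R, b < 2 & approximable (l%:R / k%:R) b.
Proof.
move=> k0; have k0R : k%:R != 0 :> R by rewrite pnatr_eq0 -lt0n.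
elim/ltn_ind: l => -[|l] IHl lk.
  by exists 0; rewrite ?ltr0n // mul0r; exact: approximable0.
have rl : (k %% l.+1 < l.+1)%N by rewrite ltn_mod.
have [|b b2 ab] := IHl _ rl; first exact: leq_trans (ltnW rl) lk.
have q0 : (0 < k %/ l.+1)%N by rewrite divn_gt0.
have [b' b'2 ab'] := approximable_divn q0 b2 (approximableC ab).
exists b' => //; move: ab'; congr approximable.
have kE : k%:R = (k %/ l.+1)%N%:R * l.+1%:R + (k %% l.+1)%N%:R :> R.
  by rewrite -natrM -natrD -divn_eq.
have q0R : (k %/ l.+1)%N%:R != 0 :> R by rewrite pnatr_eq0 -lt0n.
apply: (mulfI q0R); rewrite mulrCA divff // mulr1.
apply: (mulIf k0R); rewrite mulrBl mul1r -!mulrA !mulVf // !mulr1 {1}kE; ring.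
Qed.

End Approximable.

(** * From approximate to exact solutions *)

Section Alternating.
Variable R : realType.
Implicit Types (F : R -> R) (x y : R) (t : seq R).

(* The increment of [F] over the pieces labelled [true] when the labels of the
   pieces of [x, 1] alternate, starting with [b]; running maxima make this a
   continuous function of arbitrary cut points. *)
Fixpoint alt F (b : bool) x t : R :=
  if t is y :: t' then
    (F (Num.max x y) - F x) *+ b + alt F (~~ b) (Num.max x y) t'
  else (F 1 - F x) *+ b.

Lemma alt_start F b x y t : x <= y -> all (fun z => y <= z) t ->
  alt F b x t = (F y - F x) *+ b + alt F b y t.
Proof.
case: t => [|z t] xy /=; first by move=> _; rewrite -mulrnDl addrC subrKA.
move=> /andP[yz _]; rewrite (max_idPr yz) (max_idPr (le_trans xy yz)) addrA.
by rewrite -mulrnDl [F y - F x + _]addrC subrKA.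
Qed.

Lemma alt1 F b t : all (fun z => z <= 1) t -> alt F b 1 t = 0.
Proof.
elim: t b => [|y t IHt] b /=; first by rewrite subrr mul0rn.
by move=> /andP[y1 /IHt{}IHt]; rewrite (max_idPl y1) subrr mul0rn IHt addr0.
Qed.

(** Cuts at 1 bound empty pieces; padding with them gives all approximations the same number of
    cuts. *)
Lemma alt_pad F b x t k :
  all (fun z => z <= 1) t -> x <= 1 -> alt F b x (t ++ nseq k 1) = alt F b x t.
Proof.
elim: t b x => [|y t IHt] b x /= => [_ x1|/andP[y1 t1] x1]; last first.
  by rewrite IHt // ge_max x1 y1.
case: k => //= k; rewrite (max_idPr x1) alt1 ?addr0 //.
by apply/allP => z; rewrite mem_nseq => /andP[_ /eqP->].
Qed.

Lemma alt_of_changes (m : nat) (A : nat -> bool) (pos : nat -> R) :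
  {homo pos : i j / (i <= j)%N >-> i <= j} -> pos m.+1 = 1 ->
  exists t, [/\ size t = changes m A, all (fun y => pos 0%N <= y <= 1) t &
    forall F, alt F (A 0%N) (pos 0%N) t =
      \sum_(j < m.+1) (F (pos j.+1) - F (pos j)) *+ A j].
Proof.
elim: m A pos => [|m IHm] A pos pos_le pos1.
  exists [::]; split=> //; first by rewrite /changes big_ord0.
  by move=> F; rewrite big_ord1 /= pos1.
have [|//|t [t_sz t_all tP]] := IHm (fun j => A j.+1) (fun j => pos j.+1).
  by move=> i j ij; apply: pos_le.
have p01 : pos 0%N <= pos 1%N by exact: pos_le.
have t_all0 : all (fun y => pos 0%N <= y <= 1) t.
  by apply: sub_all t_all => y /andP[y0 ->]; rewrite (le_trans p01 y0).
have chE : changes m.+1 A = ((A 0%N != A 1%N) + changes m (fun j => A j.+1))%N.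
  by rewrite /changes big_ord_recl.
have [A01|A01] := eqVneq (A 0%N) (A 1%N).
  exists t; split=> //; first by rewrite t_sz chE A01 eqxx.
  move=> F; rewrite big_ord_recl -tP A01; apply: alt_start => //.
  by apply: sub_all t_all => y /andP[].
exists (pos 1%N :: t); split.
- by rewrite /= t_sz chE A01.
- by rewrite /= t_all0 p01 /= -pos1 pos_le.
- move=> F; rewrite big_ord_recl /= (max_idPr p01); congr (_ + _); rewrite -tP.
  by congr alt; move: A01; case: (A 0%N); case: (A 1%N).
Qed.

(** Degenerate cuts are removed: an empty piece only flips the next label, and cuts at 1 are
    dropped. *)
Lemma alt_strict b x t : x < 1 -> all (fun z => z <= 1) t ->
  exists b' t', [/\ path <%R x (rcons t' 1), (size t' <= size t)%N &
    forall F, alt F b x t = alt F b' x t'].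
Proof.
elim: t b x => [|y t IHt] b x x1 /=; first by exists b, [::]; rewrite /= x1.
move=> /andP[y1 t1]; have [yx|xy] := leP y x.
  have [b' [t' [t'p t's t'P]]] := IHt (~~ b) x x1 t1.
  exists b', t'; split=> //; first exact: leqW.
  by move=> F; rewrite subrr mul0rn add0r t'P.
have [y_lt1|] := ltP y 1; last first.
  move=> y_ge1; have -> : y = 1 by apply/eqP; rewrite eq_le y1.
  by exists b, [::]; split=> //= [|F]; rewrite ?x1 // alt1 ?addr0.
have [b' [t' [t'p t's t'P]]] := IHt (~~ b) y y_lt1 t1.
(* If the label after [y] still differs from [b], the cut stays; otherwise the two pieces merge and
   [y] is dropped. *)
move: t'P; have [->|bb'] := eqVneq b' (~~ b) => t'P.
  exists b, (y :: t'); split=> //=; first by rewrite xy.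
  by move=> F; rewrite t'P (max_idPr (ltW xy)).
have {bb'}b'E : b' = b by move: bb'; case: (b); case: (b').
exists b, t'; split; [|exact: leqW|].
  by case: (t') t'p => [|z t''] /= /andP[yz]; rewrite ?(lt_trans xy yz).
move=> F; rewrite t'P b'E; apply/esym/alt_start; first exact: ltW.
apply/allP => z zt'; have /allP := order_path_min lt_trans t'p.
by move=> /(_ z); rewrite mem_rcons inE zt' orbT => /(_ isT)/ltW.
Qed.

Lemma alt_sum F b x t : path <%R x (rcons t 1) ->
  alt F b x t = \sum_(i < (size t).+1)
    (F (nth 1 (x :: rcons t 1) i.+1) - F (nth 1 (x :: rcons t 1) i)) *+ (b (+) odd i).
Proof.
elim: t b x => [|y t IHt] b x /= => [_|/andP[xy yt]].
  by rewrite big_ord1 /= addbF.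
rewrite big_ord_recl /= addbF (max_idPr (ltW xy)); congr (_ + _).
rewrite IHt //; apply: eq_bigr => i _ /=.
by rewrite addbN addNb.
Qed.

Lemma alt_continuous (T : topologicalType) F b (f : T -> R) (s : seq (T -> R)) :
  continuous F -> continuous f -> (forall i, continuous (nth (cst 0) s i)) ->
  continuous (fun v => alt F b (f v) [seq g v | g <- s]).
Proof.
move=> cF; elim: s b f => [|g s IHs] b f cf cs /=.
  move=> v; case: b; rewrite ?mulr1n ?mulr0n; last exact: cvg_cst.
  apply: cvgB; first exact: cvg_cst.
  by apply: continuous_comp; [exact: cf|exact: cF].
have cg : continuous g by exact: (cs 0%N).
have cm : continuous (fun v => Num.max (f v) (g v)).
  by move=> v; apply: continuous_max; [exact: cf|exact: cg].
move=> v; apply: cvgD; last by apply: IHs => // i; exact: (cs i.+1).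
case: b; rewrite ?mulr1n ?mulr0n; last exact: cvg_cst.
apply: cvgB.
  by apply: (@continuous_comp _ _ _ (fun v => Num.max (f v) (g v)) F); [exact: cm|exact: cF].
by apply: (@continuous_comp _ _ _ f F); [exact: cf|exact: cF].
Qed.

End Alternating.

(** * Compactness and limits of cut points *)

Local Open Scope classical_set_scope.
Local Open Scope ring_scope.

Lemma compact_pos_lbound (R : realType) (T : topologicalType) (K : set T)
    (G : T -> R) :
  compact K -> continuous G -> (forall v, K v -> 0 < G v) ->
  exists2 e, 0 < e & forall v, K v -> e <= G v.
Proof.
move=> cK cG G0.
have cGK : compact (G @` K).
  by apply: continuous_compact cK; exact: continuous_subspaceT.
have /closed_openC oGK := compact_closed (@Rhausdorff R) cGK.
have : nbhs (0 : R) (~` (G @` K)).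
  apply: open_nbhs_nbhs; split=> // -[v Kv Gv0].
  by have := G0 v Kv; rewrite Gv0 ltxx.
move=> /nbhs_ballP[e /= e0 eP]; exists e => // v Kv; rewrite leNgt; apply/negP => Gve.
have : ball 0 e (G v) by rewrite /ball /= sub0r normrN gtr0_norm // G0.
by move=> /eP; apply; exists v.
Qed.

Lemma sum_continuous (R : realType) (T : topologicalType) (k : nat)
    (g : nat -> T -> R) :
  (forall i, continuous (g i)) -> continuous (fun v => \sum_(i < k) g i v : R).
Proof.
move=> cg; elim: k => [|k IHk] v.
  rewrite (_ : (fun v => _) = cst 0); first exact: cst_continuous.
  by apply/funext => u; rewrite big_ord0.
rewrite (_ : (fun v => _) = (fun v => \sum_(i < k) g i v) \+ g k).
  by apply: continuousD; [exact: IHk|exact: cg].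
by apply/funext => u; rewrite big_ord_recr.
Qed.

Section Limit.
Variables (R : realType) (n c : nat) (F : nat -> R -> R) (alpha : R).
Hypothesis F_cont : forall i, continuous (F i).

Let unit_seq (t : seq R) := (size t == c) && all (fun y => 0 <= y <= 1) t.

(** For each starting label the total error is continuous on the compact cube; without an exact
    solution it would be bounded away from 0. *)
Lemma alt_limit :
  (forall e : R, 0 < e -> exists b t, unit_seq t /\
    forall i, (i < n)%N -> `|alt (F i) b 0 t - alpha| <= e) ->
  exists b t, unit_seq t /\ forall i, (i < n)%N -> alt (F i) b 0 t = alpha.
Proof.
move=> approx; apply: contrapT => exact_none.
pose K := [set v : 'rV[R]_c | forall i, `[0, 1]%classic (v ord0 i)].
have cK : compact K.
  apply: (@rV_compact R c (fun=> `[0, 1]%classic)) => i; exact: segment_compact.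
pose fs := [seq (fun v : 'rV[R]_c => v ord0 i) | i <- enum 'I_c].
pose G b (v : 'rV[R]_c) :=
  \sum_(i < n) `|alt (F i) b 0 [seq f v | f <- fs] - alpha| : R.
have fsE (v : 'rV[R]_c) : [seq f v | f <- fs] = [seq v ord0 i | i <- enum 'I_c].
  by rewrite /fs -map_comp.
have cG b : continuous (G b).
  apply: (@sum_continuous _ _ n
    (fun i v => `|alt (F i) b 0 [seq f v | f <- fs] - alpha|)) => k v.
  apply: (@continuous_comp _ _ _
    (fun v => alt (F k) b 0 [seq f v | f <- fs] - alpha) Num.norm);
    last exact: norm_continuous.
  apply: continuousB; last exact: cst_continuous.
  apply: (@alt_continuous _ _ _ _ (cst 0)); [exact: F_cont|exact: cst_continuous|].
  move=> {}k; have [kc|kc] := ltnP k (size fs); last first.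
    by rewrite nth_default //; exact: cst_continuous.
  rewrite size_map -cardE card_ord in kc.
  rewrite (nth_map (Ordinal kc)) ?size_enum_ord //; exact: coord_continuous.
have G_pos b v : K v -> 0 < G b v.
  move=> Kv; rewrite lt_neqAle sumr_ge0 // andbT eq_sym; apply/negP => /eqP G0.
  apply: exact_none; exists b, [seq v ord0 i | i <- enum 'I_c]; split.
    rewrite /unit_seq size_map size_enum_ord eqxx /=.
    by apply/allP => y /mapP[i _ ->]; have := Kv i; rewrite /= in_itv.
  move=> i i_n; apply/eqP; rewrite -subr_eq0 -normr_eq0 -fsE; apply/eqP.
  by have /psumr_eq0P := G0; move=> /(_ (fun _ _ => normr_ge0 _) (Ordinal i_n) isT).
have [e1 e1_gt0 e1P] := compact_pos_lbound cK (cG true) (G_pos true).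
have [e2 e2_gt0 e2P] := compact_pos_lbound cK (cG false) (G_pos false).
(* Dividing by n + 1 makes n errors of size [e] add up to less than the minimum, also for n = 0. *)
pose e := Num.min e1 e2 / n.+1%:R.
have m0 : 0 < Num.min e1 e2 by rewrite lt_min e1_gt0.
have e0 : 0 < e by rewrite divr_gt0.
have [b [t [/andP[/eqP tc t01] tP]]] := approx e e0.
pose v : 'rV[R]_c := \row_i nth 0 t i.
have vt : [seq f v | f <- fs] = t.
  rewrite fsE; under eq_map do rewrite mxE.
  by rewrite (map_comp (nth 0 t) val) val_enum_ord -tc -/(mkseq _ _) mkseq_nth.
have Kv : K v.
  move=> i; rewrite /= mxE in_itv /=; move/allP: t01; apply; apply: mem_nth.
  by rewrite tc.
have : Num.min e1 e2 <= G b v.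
  by case: b {tP}; rewrite ge_min ?(e1P v Kv) // (e2P v Kv) orbT.
have : G b v <= n%:R * e.
  rewrite mulr_natl -[n in X in _ <= X]card_ord -sumr_const; apply: ler_sum => i _.
  by rewrite vt; exact: tP.
have : n%:R * e < Num.min e1 e2.
  rewrite /e mulrCA -[ltRHS]mulr1 ltr_pM2l // ltr_pdivrMr // mul1r ltr_nat.
  exact: ltnSn.
lra.
Qed.

End Limit.

(** * Densities and distribution functions *)

Section Density.
Variable R : realType.
Local Notation leb := (@lebesgue_measure R).
Implicit Type mu : probability (measurableTypeR R) R.

(** The values at the breakpoints are arbitrary but finitely many, so their absolute values can be
    added to the bound. *)
Lemma step_bounded (f : R -> R) a t : path <%R a t ->
  (forall i, (i < size t)%N -> exists v, forall x,
     nth 1 (a :: t) i < x < nth 1 (a :: t) i.+1 -> f x = v) ->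
  exists2 B : R, 0 <= B & forall x, a <= x <= last a t -> f x <= B.
Proof.
elim: t a => [|y t IHt] a /=.
  move=> _ _; exists `|f a| => // x; rewrite -eq_le => /eqP->; exact: ler_norm.
move=> /andP[ay yt] ft; have [|B B0 BP] := IHt y yt.
  by move=> i it; exact: (ft i.+1).
have [v vP] := ft 0%N isT.
exists (B + `|f a| + `|v|) => [|x /andP[ax xt]]; first by rewrite !addr_ge0.
have fa := ler_norm (f a); have v0 := ler_norm v.
have n1 := normr_ge0 (f a); have n2 := normr_ge0 v.
have [yx|xy] := leP y x; first by have := BP x; rewrite yx xt => /(_ isT); lra.
move: ax; rewrite le_eqVlt => /predU1P[<-|ax]; first by lra.
by have := vP x; rewrite /= ax xy => /(_ isT) ->; lra.
Qed.

Lemma piecewise_constant_bounded (f : R -> R) : piecewise_constant f ->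
  exists2 B : R, 0 <= B & forall x, 0 <= x <= 1 -> f x <= B.
Proof.
move=> [s sp fs]; have [|B B0 BP] := step_bounded sp (f := f).
  by move=> i; rewrite size_rcons ltnS; exact: fs.
by exists B => // x; have := BP x; rewrite last_rcons.
Qed.

Lemma le_lebesgue mu (f : R -> R) : pc_density mu f ->
  exists2 B : R, 0 <= B &
    forall A : set (measurableTypeR R), measurable A -> (mu A <= B%:E * leb A)%E.
Proof.
move=> [f0 /piecewise_constant_bounded[B B0 fB] muE]; exists B => // A mA.
rewrite muE //; set D := (_ `&` _).
have mD : measurable D by exact: measurableI.
have D01 x : D x -> 0 <= x <= 1 by move=> [_]; rewrite /= in_itv.
apply: (@le_trans _ _ (B%:E * leb D)%E); last first.
  by apply: lee_wpmul2l; rewrite ?lee_fin // le_measure ?inE //; exact: subIsetl.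
rewrite -(integral_cst leb mD) !ge0_integralE; last 2 first.
- by move=> x /D01/f0; rewrite lee_fin.
- by move=> x _; rewrite /= lee_fin.
(* As suprema over simple functions the integrals compare directly: what lies below [f] on [D] lies
   below [B] there. *)
apply: ge_ereal_sup => _ [g /= gf <-]; apply: ereal_sup_ubound => /=; exists g => // x.
apply: le_trans (gf x) _; rewrite /patch; case: ifPn => // /set_mem/D01/fB.
by rewrite lee_fin.
Qed.

Definition dist mu (x : R) : R := fine (mu `]-oo, x]%classic).

Section Dist.
Variables (mu : probability (measurableTypeR R) R) (B : R).
Hypothesis B0 : 0 <= B.
Hypothesis muB : forall A : set (measurableTypeR R), measurable A ->
  (mu A <= B%:E * leb A)%E.

Lemma mu_itv_oc x y : x <= y -> mu `]x, y]%classic = (dist mu y - dist mu x)%:E.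
Proof.
move=> xy.
have := @measureU _ _ _ mu `]-oo, x]%classic `]x, y]%classic.
rewrite -itv_bndbnd_setU ?bnd_simp // => H.
have {}H : mu `]-oo, y]%classic = (mu `]-oo, x]%classic + mu `]x, y]%classic)%E.
  apply: H => //; apply/seteqP; split=> // z /=; rewrite !in_itv /= => -[zx /andP[xz _]].
  by have := le_lt_trans zx xz; rewrite ltxx.
have fin A : measurable A -> mu A \is a fin_num by exact: fin_num_measure.
rewrite /dist H fineD ?fin // addrC addKr fineK // fin //.
Qed.

Lemma mu_itv_cc x y : x <= y -> mu `[x, y]%classic = (dist mu y - dist mu x)%:E.
Proof.
move=> xy; rewrite -mu_itv_oc //.
rewrite -(@setU1itv _ _ (BRight y) x false) ?bnd_simp // measureU //.
  rewrite -[RHS]add0e; congr (_ + _)%E.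
  apply/eqP; rewrite eq_le measure_ge0 andbT.
  by apply: le_trans (muB _) _ => //; rewrite lebesgue_measure_set1 mule0.
by apply/seteqP; split=> // z /= [->]; rewrite in_itv /= ltxx.
Qed.

Lemma dist_mono_lip x y : x <= y -> 0 <= dist mu y - dist mu x <= B * (y - x).
Proof.
move=> xy; rewrite -!lee_fin -mu_itv_oc // measure_ge0 /=.
apply: le_trans (muB _) _ => //; rewrite EFinM lee_wpmul2l ?lee_fin //.
rewrite lebesgue_measure_itv /= lte_fin; case: ifPn => // _.
by rewrite lee_fin subr_ge0.
Qed.

Lemma dist_continuous : continuous (dist mu).
Proof.
move=> x; apply/cvgrPdist_le => e e0.
(* [B] may be 0, and a positive Lipschitz constant is needed as a divisor. *)
have B1 : 0 < B + 1 by rewrite ltr_wpDl.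
near=> y.
have lip u v : u <= v -> `|dist mu u - dist mu v| <= (B + 1) * `|u - v|.
  move=> uv; have /andP[d0 dB] := dist_mono_lip uv.
  rewrite distrC ger0_norm // distrC [`|v - u|]ger0_norm ?subr_ge0 //.
  by move: dB uv; nra.
have {lip} : `|dist mu x - dist mu y| <= (B + 1) * `|x - y|.
  have [xy|/ltW yx] := leP x y; first exact: lip.
  by rewrite distrC [`|x - y|]distrC; exact: lip.
move=> /le_trans; apply; rewrite mulrC -ler_pdivlMr //.
near: y; apply: cvgr_dist_le; last exact: divr_gt0.
exact: cvg_id.
Unshelve. all: by end_near. Qed.

End Dist.
End Density.

(** * The measure of the plus part as an alternating sum *)

Section PlusPart.
Variables (R : realType) (mu : probability (measurableTypeR R) R) (t : seq R).
Hypothesis mu_itv : forall x y : R, x <= y ->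
  mu `[x, y]%classic = (dist mu y - dist mu x)%:E.
Hypothesis mu01 : mu `[0, 1]%classic = 1%E.
Hypothesis t_sub : subdivision t.
Local Notation e := (endpoint t).

Definition alt_labels (b : bool) : (size t).+1.-tuple bool :=
  [tuple b (+) odd i | i < (size t).+1].

Local Notation P b := (plus_part (in_tuple t) (alt_labels b)).

Lemma endpoint_le i : (i <= size t)%N -> e i <= e i.+1.
Proof.
move=> it; apply: ltW; have /(pathP 1) := t_sub.
by apply; rewrite size_rcons ltnS.
Qed.

Lemma endpoint_last : e (size t).+1 = 1.
Proof. by rewrite /endpoint /= nth_rcons ltnn eqxx. Qed.

Lemma dist01 : dist mu 1 - dist mu 0 = 1.
Proof. by move: mu01; rewrite mu_itv // => -[]. Qed.

Let J b i : set (measurableTypeR R) :=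
  if b (+) odd i then `[e i, e i.+1]%classic else set0.

Let P_bigcup b : P b = \big[setU/set0]_(i < (size t).+1) J b i.
Proof.
rewrite -bigcup_mkord /plus_part; apply/seteqP; split=> [x [i /=]|x [i /= it]].
  by rewrite tnth_mktuple => bi xi; exists i; [exact: ltn_ord|rewrite /J bi].
rewrite /J; case: ifP => // bi xi.
by exists (Ordinal it) => //=; rewrite tnth_mktuple.
Qed.

Let mJ b i : measurable (J b i).
Proof. by rewrite /J; case: ifP => _; [exact: measurable_itv|exact: measurable0]. Qed.

Let mP b : measurable (P b).
Proof. by rewrite P_bigcup -bigcup_mkord; apply: fin_bigcup_measurable. Qed.

Let mu_P_le b : (mu (P b) <= (alt (dist mu) b 0 t)%:E)%E.
Proof.
rewrite alt_sum // -sumEFin P_bigcup.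
apply: le_trans (Boole_inequality mu _) _ => //.
apply: lee_sum => i _; rewrite /J; case: ifP => _; last by rewrite measure0 mulr0n.
have /eqP := mu_itv (endpoint_le (ltn_ord i : (i <= size t)%N)).
by rewrite eq_le => /andP[].
Qed.

Let cover b : `[0, 1]%classic `<=` P b `|` P (~~ b).
Proof.
move=> x; rewrite /= in_itv /= => /andP[x0 x1].
have [i xi i_min] : exists2 i, x <= e i.+1 & forall j, x <= e j.+1 -> (i <= j)%N.
  have ex_i : exists i, x <= e i.+1 by exists (size t); rewrite endpoint_last.
  by exists (ex_minn ex_i); case: ex_minnP.
have it : (i < (size t).+1)%N by rewrite ltnS i_min // endpoint_last.
have ei : e i <= x.
  case: i i_min {xi it} => // i i_min; rewrite leNgt; apply/negP => /ltW /i_min.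
  by rewrite ltnn.
have Pi b' : b' (+) odd i -> P b' x.
  by move=> bi; exists (Ordinal it); rewrite /= ?tnth_mktuple // in_itv /= ei.
by case: (boolP (b (+) odd i)) => [/Pi|]; [left|rewrite -addNb => /Pi; right].
Qed.

(* Closed pieces overlap, so only subadditivity is used: the two label classes
   cover [0, 1], and their upper bounds already add up to its measure. *)
Lemma mu_plus_part b : mu (P b) = (alt (dist mu) b 0 t)%:E.
Proof.
have alt2 : alt (dist mu) b 0 t + alt (dist mu) (~~ b) 0 t = 1.
  rewrite !alt_sum // -big_split /=.
  under eq_bigr => i _.
    rewrite addNb -mulrnDr (_ : (_ + _)%N = 1%N) ?mulr1n; last by case: (_ (+) _).
    over.
  rewrite -(big_mkord xpredT (fun i => dist mu (e i.+1) - dist mu (e i))).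
  by rewrite telescope_sumr // endpoint_last dist01.
have fin b' : mu (P b') \is a fin_num by apply: fin_num_measure; exact: mP.
have le1 : (1 <= mu (P b) + mu (P (~~ b)))%E.
  rewrite -mu01; apply: le_trans (le_measure mu _ _ (@cover b)) _; rewrite ?inE //.
    by apply: measurableU; exact: mP.
  by apply: measureU2; exact: mP.
have := mu_P_le b; have := mu_P_le (~~ b); move: le1.
rewrite -(fineK (fin b)) -(fineK (fin (~~ b))) -EFinD !lee_fin => h1 h2 h3.
by congr (_%:E); apply/eqP; rewrite eq_le h3 /=; move: alt2; lra.
Qed.

End PlusPart.

(** * Exact solutions and the bounds on cuts *)

Section Solve.
Variable R : realType.

(** On a fine uniform grid the cells have small measure for every agent, so the grid labellings are
    nearly exact and the limit is exact. Letting [alpha'] vary allows shares that are only limits of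
    approximable ones. *)
Lemma approximable_solvable (alpha b : R) (n : nat)
    (mu : 'I_n -> probability (measurableTypeR R) R) :
  icd_instance mu ->
  (forall e : R, 0 < e -> exists alpha' b', [/\ `|alpha' - alpha| <= e,
     b' <= b & approximable alpha' b']) ->
  exactly_solvable_within alpha mu (b * n%:R).
Proof.
move=> mu_icd approx.
have /choice[Bf BfP] : forall i : 'I_n, exists B : R, 0 <= B /\
    forall A : set (measurableTypeR R), measurable A ->
      (mu i A <= B%:E * lebesgue_measure A)%E.
  by move=> i; have [f /le_lebesgue[B B0 BP]] := mu_icd i; exists B.
have mu01 i : mu i `[0, 1]%classic = 1%E.
  have [f [_ _ muE]] := mu_icd i.
  by rewrite muE // setIid -[X in integral _ X](setTI `[0, 1]%classic) -muE // probability_setT.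
have mu_itv i x y : x <= y -> mu i `[x, y]%classic = (dist (mu i) y - dist (mu i) x)%:E.
  by move=> xy; apply: mu_itv_cc xy; case: (BfP i) => _; exact.
(* The distribution functions are extended by 0 to all natural indices. *)
pose F i : R -> R := oapp (fun j => dist (mu j)) (fun=> 0) (insub i : option 'I_n).
have FE (i : 'I_n) : F i = dist (mu i) by rewrite /F valK.
have F_cont i : continuous (F i).
  rewrite /F; case: insub => [j|] /=; last exact: cst_continuous.
  by have [Bj0 BjP] := BfP j; exact: dist_continuous Bj0 BjP.
pose B := \sum_i Bf i.
have B0 : 0 <= B by apply: sumr_ge0 => i _; case: (BfP i).
have F_lip i x y : x <= y -> 0 <= F i y - F i x <= B * (y - x).
  move=> xy; rewrite /F; case: insub => [j|] /=; last first.
    by rewrite subrr lexx mulr_ge0 // subr_ge0.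
  have [Bj0 BjP] := BfP j.
  have /andP[-> /= le1] := dist_mono_lip Bj0 BjP xy.
  apply: le_trans le1 _; rewrite ler_wpM2r ?subr_ge0 //.
  rewrite /B (bigD1 j) //= lerDl sumr_ge0 // => k _; by case: (BfP k).
pose c := Num.truncn (b * n%:R).
have [b' [t [/andP[/eqP tc t01] tP]]] : exists b' t,
    ((size t == c) && all (fun y => 0 <= y <= 1) t) /\
    forall i, (i < n)%N -> alt (F i) b' 0 t = alpha.
  apply: alt_limit => // e e0.
  have e20 : 0 < e / 2 by rewrite divr_gt0.
  have [alpha' [b' [a_e b'b /(_ n)[C C0 CP]]]] := approx _ e20.
  (* Chosen so that C B / (m + 1) <= e / 2. *)
  pose m := Num.truncn (C * B / (e / 2)).
  have m0 : 0 < m.+1%:R :> R by [].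
  pose pos j : R := j%:R / m.+1%:R.
  have posS j : pos j.+1 - pos j = m.+1%:R^-1.
    by rewrite /pos -mulrBl -natr1 addrC addKr mul1r.
  have pos_le : {homo pos : i j / (i <= j)%N >-> i <= j}.
    by move=> i j ij; rewrite ler_pM2r ?invr_gt0 // ler_nat.
  have pos0 : pos 0%N = 0 by rewrite /pos mul0r.
  have pos1 : pos m.+1 = 1 by rewrite /pos divff // gt_eqF.
  have [|A Ab AP] := CP m (fun i j => F i (pos j.+1) - F i (pos j)) (B / m.+1%:R).
    by move=> i j; have := F_lip i _ _ (pos_le _ _ (leqnSn j)); rewrite posS.
  have [s [s_sz s_all sP]] := alt_of_changes A pos_le pos1.
  have sc : (size s <= c)%N.
    rewrite s_sz truncn_ge_nat; last by apply: le_trans (le_trans Ab _); rewrite ?ler_wpM2r.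
    by apply: le_trans Ab _; rewrite ler_wpM2r.
  exists (A 0%N), (s ++ nseq (c - size s) 1); split.
    rewrite size_cat size_nseq subnKC // eqxx all_cat /= -{1}pos0 s_all /=.
    by apply/allP => y; rewrite mem_nseq => /andP[_ /eqP->]; rewrite ler01 lexx.
  move=> i i_n; rewrite alt_pad //; last by apply: sub_all s_all => y /andP[].
  rewrite -{1}pos0 sP.
  have sum1 : \sum_(j < m.+1) (F i (pos j.+1) - F i (pos j)) = 1.
    rewrite -(big_mkord xpredT (fun j => F i (pos j.+1) - F i (pos j))).
    rewrite telescope_sumr // pos0 pos1 (FE (Ordinal i_n)).
    exact: dist01 (mu_itv _) (mu01 _).
  have := AP i i_n; rewrite sum1 mulr1.
  have : C * (B / m.+1%:R) <= e / 2.
    rewrite mulrA ler_pdivrMr // [leRHS]mulrC -ler_pdivrMr //.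
    exact: ltW (truncnS_gt _).
  set S := \sum_(j < _) _ => h1 h2.
  have -> : S - alpha = (S - alpha') + (alpha' - alpha) by ring.
  apply: le_trans (ler_normD _ _) _.
  by apply: le_trans (lerD (le_trans h2 h1) a_e) _; rewrite -splitr.
have [|b2 [t' [t'_sub t'_sz t'P]]] := alt_strict b' (t := t) (ltr01 : 0 < 1 :> R).
  by apply: sub_all t01 => y /andP[].
exists (size t'), (in_tuple t'), (alt_labels t' b2); split.
  split=> // i; rewrite (mu_plus_part (mu_itv i) (mu01 i)) //.
  by rewrite -FE -t'P tP.
(* The floor [c] is at most b n only once b n >= 0; this holds since b n bounds a number of changes,
   here for zero measures. *)
have bn0 : 0 <= b * n%:R.
  have [a' [b1 [_ b1b /(_ n)[C C0 CP]]]] := approx 1 ltr01.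
  have [|A Ab _] := CP 0%N (fun _ _ => 0) 0; first by move=> i j; rewrite lexx.
  by apply: le_trans (le_trans Ab _); rewrite ?ler_wpM2r.
apply: (@le_trans _ _ c%:R); first by rewrite ler_nat -tc.
by rewrite truncn_le.
Qed.

(** [Qstar] speaks of real numbers, so numerator and denominator must be recovered from the
    quotient. *)
Lemma lowest_terms (l k l' k' : nat) : (0 < k)%N -> (0 < k')%N ->
  coprime l k -> coprime l' k' -> l%:R / k%:R = l'%:R / k'%:R :> R ->
  l = l' /\ k = k'.
Proof.
move=> k0 k'0 lk l'k' /eqP; rewrite eqr_div ?pnatr_eq0 -?lt0n // -!natrM eqr_nat => /eqP E.
have kk' : k = k'.
  apply/eqP; rewrite eqn_dvd -(Gauss_dvdr k' (m := k) (n := l)) 1?coprime_sym //.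
  rewrite -(Gauss_dvdr k (m := k') (n := l')) 1?coprime_sym //.
  by rewrite E dvdn_mull // -E dvdn_mull.
split=> //; apply/eqP; move/eqP: E; rewrite kk'.
by rewrite eqn_pmul2r.
Qed.

(** The bound 2(k - 1)/k is reproduced by division: (2(k - 1)/k + 2(p - 1))/p = 2(kp - 1)/(kp).
    Complementing keeps the denominator. *)
Lemma Qstar_approximable (x : R) : Qstar x -> exists l k : nat,
  [/\ (0 < k)%N, (l <= k)%N, coprime l k, x = l%:R / k%:R &
      approximable x (2 * (k%:R - 1) / k%:R)].
Proof.
have step (l k p : nat) : (0 < k)%N -> coprime l k -> prime p -> ~~ (p %| l)%N ->
    (exists l' k' : nat, [/\ (0 < k')%N, (l' <= k')%N, coprime l' k',
      l%:R / k%:R = l'%:R / k'%:R :> R &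
      approximable (l%:R / k%:R : R) (2 * (k'%:R - 1) / k'%:R)]) ->
    [/\ (0 < k * p)%N, (l <= k * p)%N, coprime l (k * p) &
      approximable (l%:R / (k * p)%:R : R) (2 * ((k * p)%:R - 1) / (k * p)%:R)].
  move=> k0 lk p_pr pl [l' [k' [k'0 l'k' cop' E ap]]].
  have p0 := prime_gt0 p_pr.
  have [ll kk] := lowest_terms k0 k'0 lk cop' E; subst l' k'.
  split.
  - by rewrite muln_gt0 k0.
  - exact: leq_trans l'k' (leq_pmulr _ p0).
  - by rewrite coprimeMr lk coprime_sym prime_coprime.
  - have := approximable_div p_pr ap; rewrite natrM invfM mulrA.
    congr approximable; field.
    by rewrite !pnatr_eq0 -!lt0n k0 p0.
move=> Qx; elim: Qx => {x}.
- exists 0%N, 1%N; split; rewrite ?mul0r ?coprime0n // subrr mulr0 mul0r.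
  exact: approximable0.
- exists 1%N, 1%N; split; rewrite ?divr1 ?coprime1n // subrr mulr0.
  by have := approximableC (@approximable0 R); rewrite subr0.
- move=> l k p k0 lk _ IH p_pr pl.
  by have [? ? ? ?] := step l k p k0 lk p_pr pl IH; exists l, (k * p)%N.
- move=> l k p k0 lk _ IH p_pr pl.
  have [kp0 lkp cop ap] := step l k p k0 lk p_pr pl IH.
  exists (k * p - l)%N, (k * p)%N; split=> //.
  + exact: leq_subr.
  + move: cop; rewrite -{1 3}(subnK lkp) /coprime gcdnDr gcdnDl.
    by rewrite gcdnC.
  + by rewrite natrB // mulrBl divff // pnatr_eq0 -lt0n.
  + exact: approximableC.
Qed.

Lemma rational01 (alpha : R) : 0 <= alpha <= 1 -> rational alpha ->
  exists l k : nat, [/\ (0 < k)%N, (l <= k)%N & alpha = l%:R / k%:R].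
Proof.
move=> /andP[a0 a1] /rationalP[a [[|k] aE]].
  (* A zero denominator makes the quotient 0. *)
  by exists 0%N, 1%N; split; rewrite // aE invr0 mulr0 mul0r.
have k0 : 0 < k.+1%:R :> R by [].
case: a aE => l aE.
  by exists l, k.+1; split=> //; move: a1; rewrite aE ler_pdivrMr // mul1r ler_nat.
by move: a0; rewrite aE pmulr_lge0 ?invr_gt0 // ler0z.
Qed.

End Solve.

Theorem theorem4p1 (R : realType) :
  [/\ forall l k : nat, (0 < k)%N -> coprime l k -> Qstar (l%:R / k%:R : R) ->
        forall (n : nat) (mu : 'I_n -> probability (measurableTypeR R) R),
          icd_instance mu ->
          exactly_solvable_within (l%:R / k%:R) mu
            (2 * (k%:R - 1) / k%:R * n%:R),
      forall alpha : R, 0 <= alpha <= 1 -> rational alpha -> ~ Qstar alpha ->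
        exists2 c_alpha : R, 0 < c_alpha &
          forall (n : nat) (mu : 'I_n -> probability (measurableTypeR R) R),
            icd_instance mu ->
            exactly_solvable_within alpha mu ((2 - c_alpha) * n%:R)
    & forall alpha : R, 0 <= alpha <= 1 -> irrational alpha ->
        forall (n : nat) (mu : 'I_n -> probability (measurableTypeR R) R),
          icd_instance mu ->
          exactly_solvable_within alpha mu (2 * n%:R)].
Proof.
split.
- move=> l k k0 lk /Qstar_approximable[l' [k' [k'0 _ l'k' E ap]]] n mu mu_icd.
  have [_ kk'] := lowest_terms k0 k'0 lk l'k' E; rewrite -kk' in ap.
  apply: approximable_solvable => // e e0; exists (l%:R / k%:R), (2 * (k%:R - 1) / k%:R).
  by rewrite subrr normr0 ltW.
- move=> alpha a01 a_rat _; have [l [k [k0 lk ->]]] := rational01 a01 a_rat.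
  have [b b2 ap] := approximable_rational R k0 lk.
  exists (2 - b) => [|n mu mu_icd]; first by rewrite subr_gt0.
  rewrite opprB addrC subrK; apply: approximable_solvable => // e e0.
  by exists (l%:R / k%:R), b; rewrite subrr normr0 ltW.
- move=> alpha /andP[a0 a1] _ n mu mu_icd.
  apply: approximable_solvable => // e e0.
  (* The fraction l/k lies within 1/k <= e below [alpha]. Its bound [b] depends on [e] but never
     exceeds 2. *)
  pose k := (Num.truncn e^-1).+1; pose l := Num.truncn (alpha * k%:R).
  have k0 : 0 < k%:R :> R by [].
  have ak0 : 0 <= alpha * k%:R by rewrite mulr_ge0.
  have lk : (l <= k)%N.
    by rewrite -(ler_nat R) (@le_trans _ _ (alpha * k%:R)) ?truncn_le // ler_piMl.
  have [b b2 ap] := approximable_rational R (ltn0Sn _ : (0 < k)%N) lk.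
  exists (l%:R / k%:R), b; split=> //; last exact: ltW.
  have /andP[h1 h2] := truncn_itv ak0.
  have ek : k%:R^-1 <= e.
    rewrite -[e]invrK lef_pV2 ?posrE ?invr_gt0 //; exact: ltW (truncnS_gt _).
  apply: le_trans ek; rewrite distrC ger0_norm; last first.
    by rewrite subr_ge0 ler_pdivrMr.
  rewrite -(ler_pM2r k0) mulVf ?gt_eqF // mulrBl -mulrA mulVf ?gt_eqF // mulr1.
  by move: h2; rewrite -natr1 -/l; lra.
Qed.
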